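(* Let $K=F^{(s)}$ be the local field of positive characteristic $p$, let $M,N\in\mathbb N$, and let $E\subset K_M^\perp$ be an $(N,M)$-elementary set. If $\varphi\in L_2(K)$ satisfies $|\hat\varphi(\chi)|=\mathbf 1_E(\chi)$ on $X$, then the system of shifts $(\varphi(x\dot-h))_{h\in H_0}$ is an orthonormal system in $L_2(K)$.
   Context: $\mathbb N=\{1,2,\dots\}$; $p$ is a prime, $s\in\mathbb N$. $GF(p^s)$ is the finite field of $p^s$ elements, realized as vectors $\mathbf a=(a^{(0)},\dots,a^{(s-1)})$ with $a^{(l)}\in GF(p)=\{0,\dots,p-1\}$; addition is coordinatewise mod $p$, multiplication is multiplication of the polynomials $\sum_l a^{(l)}t^l$ over $GF(p)$ modulo a fixed irreducible polynomial of degree $s$. $K=F^{(s)}$ consists of sequences $a=(\mathbf a_j)_{j\in\mathbb Z}$, $\mathbf a_j\in GF(p^s)$, with only finitely many nonzero $\mathbf a_j$ with $j<0$; addition $\dot+$ (subtraction $\dot-$) is coordinatewise and multiplication is convolution. $K_n=\{a\in K:\mathbf a_j=\mathbf 0\ \forall j<n\}$, $n\in\mathbb Z$, is a neighbourhood basis of zero consisting of compact subgroups of the additive group $K^+$. For $\lambda\in GF(p^s)$, $\lambda a=(\lambda\mathbf a_j)_j$. $g_n\in K$ has $(1,0,\dots,0)$ in position $n$ and $\mathbf 0$ elsewhere. $H_0=\{\mathbf a_{-1}g_{-1}\dot+\dots\dot+\mathbf a_{-l}g_{-l}: l\in\mathbb N,\ \mathbf a_j\in GF(p^s)\}$. $X$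 is the group of continuous characters of $K^+$, $(\chi,x)=\chi(x)$. For $k\in\mathbb Z$, $\mathbf u\in GF(p^s)$, $\mathbf r_k^{\mathbf u}\in X$ is $\mathbf r_k^{\mathbf u}(x)=\prod_{l=0}^{s-1}\exp\left(\frac{2\pi i}{p}u^{(l)}x_k^{(l)}\right)$, where $x=(\mathbf x_k)$, $\mathbf x_k=(x_k^{(0)},\dots,x_k^{(s-1)})$. $K_n^\perp=\{\chi\in X:\chi(x)=1\ \forall x\in K_n\}$. $\mu,\nu$ are Haar measures on $K^+$ and $X$ with $\mu(K_0)=1$, $\nu(K_0^\perp)=1$; $\hat\varphi$ is the Fourier transform, $\hat\varphi(\chi)=\int_K\varphi(x)\overline{(\chi,x)}\,d\mu(x)$ (extended to $L_2$). A set $E\subset X$ is $(N,M)$-elementary if it is a disjoint union of $p^{sN}$ cosets $K_{-N}^\perp\zeta_j$, $j=0,\dots,p^{sN}-1$, with $\zeta_j=\xi_j\eta_j$, where $\xi_j=\mathbf r_{-N}^{\alpha_{-N}}\mathbf r_{-N+1}^{\alpha_{-N+1}}\cdots\mathbf r_{-1}^{\alpha_{-1}}$, the vectors $\alpha_{-N},\dots,\alpha_{-1}\in GF(p^s)$ being determined by $j=\sum_{l=0}^{N-1}\left(\alpha_{-N+l}^{(0)}+\alpha_{-N+l}^{(1)}p+\dots+\alpha_{-N+l}^{(s-1)}p^{s-1}\right)p^{sl}$, and $\eta_j=\mathbf r_0^{\alpha_0}\cdots\mathbf r_{M-1}^{\alpha_{M-1}}$ for some $\alpha_0,\dots,\alpha_{M-1}\in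 GF(p^s)$ (depending on $j$), such that: (1) $\bigsqcup_{j}K_{-N}^\perp\xi_j=K_0^\perp$ and $K_{-N}^\perp\xi_0=K_{-N}^\perp$; (2) for every $l=0,1,\dots,M+N-1$, $(K_{-N+l+1}^\perp\setminus K_{-N+l}^\perp)\cap E\neq\emptyset$. *)

(* Defs.v *)
From HB Require Import structures.
From mathcomp Require Import all_boot all_order all_algebra all_fingroup all_field.
From mathcomp Require Import all_classical all_reals all_analysis.
From mathcomp Require Import complex.
From mathcomp Require Import zify.

Set Implicit Arguments.
Unset Strict Implicit.
Unset Printing Implicit Defensive.

Import Order.TTheory GRing.Theory Num.Theory.
Import numFieldNormedType.Exports.
Import ComplexField.Normc.

Local Open Scope classical_set_scope.
Local Open Scope ring_scope.
Local Open Scope complex_scope.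

Section laurent_def.
Variable F : fieldType.

Definition laurent_set : set (int -> F) :=
  [set a | finite_set [set j : int | j < 0 /\ a j != 0]].

Definition laurent : Type := set_type laurent_set.

HB.instance Definition _ := gen_eqMixin laurent.
HB.instance Definition _ := gen_choiceMixin laurent.

Definition lcoef (a : laurent) : int -> F := set_val a.

Definition Laurent (a : int -> F) (ha : laurent_set a) : laurent :=
  SigSub (mem_set ha).

Lemma lcoefE a ha : lcoef (@Laurent a ha) = a. Proof. by []. Qed.

Lemma laurentP (a b : laurent) : lcoef a =1 lcoef b -> a = b.
Proof. by move=> ab; apply/val_inj/funext. Qed.

Lemma laurent_setP (a : int -> F) :
  laurent_set a <-> exists n : nat, forall j, j < - n%:Z -> a j = 0.
Proof.
split=> [/finite_seqP[r ar]|[n an]].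
  exists (\sum_(i <- r) `|i|)%N => j jn; apply/eqP/negPn/negP => aj.
  have jr : j \in r.
    suff : [set` r] j by [].
    by rewrite -ar /=; split => //; apply: lt_le_trans jn _; lia.
  have : (`|j| <= \sum_(i <- r) `|i|)%N by rewrite (big_rem _ jr)/= leq_addr.
  lia.
apply: (@sub_finite_set _ _ [set (- i.+1%:Z) | i in `I_n]).
  move=> j /= [j0 aj]; exists (`|j|.-1)%N; last by lia.
  case: (ltP j (- n%:Z)) => [/an aj0|]; last by lia.
  by rewrite aj0 eqxx in aj.
exact/finite_image/finite_II.
Qed.

Lemma lcoef_lb (a : laurent) :
  exists n : nat, forall j, j < - n%:Z -> lcoef a j = 0.
Proof. by apply/laurent_setP; exact: set_valP. Qed.

Lemma lcoef_lb2 (a b : laurent) :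
  exists n : nat, forall j, j < - n%:Z -> lcoef a j = 0 /\ lcoef b j = 0.
Proof.
have [n an] := lcoef_lb a; have [m bm] := lcoef_lb b.
by exists (n + m)%N => j jn; split; [apply: an|apply: bm]; lia.
Qed.

Fact laurent0_proof : laurent_set (fun=> 0).
Proof. by apply/laurent_setP; exists 0%N. Qed.

Fact laurentN_proof (a : laurent) : laurent_set (fun j => - lcoef a j).
Proof.
have [n an] := lcoef_lb a; apply/laurent_setP.
by exists n => j /an ->; rewrite oppr0.
Qed.

Fact laurentD_proof (a b : laurent) :
  laurent_set (fun j => lcoef a j + lcoef b j).
Proof.
have [n abn] := lcoef_lb2 a b; apply/laurent_setP.
by exists n => j /abn[-> ->]; rewrite addr0.
Qed.

Fact laurentZ_proof (c : F) (a : laurent) : laurent_set (fun j => c * lcoef a j).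
Proof.
have [n an] := lcoef_lb a; apply/laurent_setP.
by exists n => j /an ->; rewrite mulr0.
Qed.

Definition laurent0 := Laurent laurent0_proof.
Definition laurentN a := Laurent (laurentN_proof a).
Definition laurentD a b := Laurent (laurentD_proof a b).
Definition laurentZ c a := Laurent (laurentZ_proof c a).

Fact laurentDA : associative laurentD.
Proof. by move=> a b c; apply: laurentP => j; rewrite /laurentD !lcoefE addrA. Qed.
Fact laurentDC : commutative laurentD.
Proof. by move=> a b; apply: laurentP => j; rewrite /laurentD !lcoefE addrC. Qed.
Fact laurent0D : left_id laurent0 laurentD.
Proof. by move=> a; apply: laurentP => j; rewrite /laurentD !lcoefE add0r. Qed.
Fact laurentND : left_inverse laurent0 laurentN laurentD.
Proof. by move=> a; apply: laurentP => j; rewrite /laurentD !lcoefE addNr. Qed.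

HB.instance Definition _ := GRing.isZmodule.Build laurent
  laurentDA laurentDC laurent0D laurentND.

Fact laurentZA c d a : laurentZ c (laurentZ d a) = laurentZ (c * d) a.
Proof. by apply: laurentP => j; rewrite /laurentZ !lcoefE mulrA. Qed.
Fact laurentZ1 : left_id 1 laurentZ.
Proof. by move=> a; apply: laurentP => j; rewrite /laurentZ !lcoefE mul1r. Qed.
Fact laurentZDr : right_distributive laurentZ +%R.
Proof. by move=> c a b; apply: laurentP => j; rewrite /laurentZ !lcoefE mulrDr. Qed.
Fact laurentZDl a : {morph laurentZ^~ a : c d / c + d}.
Proof. by move=> c d; apply: laurentP => j; rewrite /laurentZ !lcoefE mulrDl. Qed.

HB.instance Definition _ := GRing.Zmodule_isLmodule.Build F laurent
  laurentZA laurentZ1 laurentZDr laurentZDl.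

Lemma lcoef0 j : lcoef 0 j = 0. Proof. by []. Qed.
Lemma lcoefD a b j : lcoef (a + b) j = lcoef a j + lcoef b j. Proof. by []. Qed.
Lemma lcoefN a j : lcoef (- a) j = - lcoef a j. Proof. by []. Qed.
Lemma lcoefB a b j : lcoef (a - b) j = lcoef a j - lcoef b j. Proof. by []. Qed.
Lemma lcoefZ c a j : lcoef (c *: a) j = c * lcoef a j. Proof. by []. Qed.

(* all but finitely many terms of the sum vanish, see [lconvE] *)
Definition lconv (a b : laurent) (n : int) : F :=
  \sum_(i \in [set: int]) lcoef a i * lcoef b (n - i).

Lemma lconvE (a b : laurent) (m m' N k : nat) :
  (forall j, j < - m%:Z -> lcoef a j = 0) ->
  (forall j, j < - m'%:Z -> lcoef b j = 0) -> (k < N)%N ->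
  lconv a b (k%:Z - (m + m')%:Z) =
  ((\poly_(i < N) lcoef a (i%:Z - m%:Z)) *
   (\poly_(i < N) lcoef b (i%:Z - m'%:Z)))`_k.
Proof.
move=> am bm kN; rewrite coefM /lconv.
rewrite -(@fsbig_widen _ _ _ _ [set (i%:Z - m%:Z) | i in `I_k.+1])//=; last first.
  move=> i [_ /= iI]; case: (ltP i (- m%:Z)) => [/am ->|im]; rewrite ?mul0r//.
  rewrite (bm (k%:Z - (m + m')%:Z - i)) ?mulr0//.
  case: (leP i (k%:Z - m%:Z)) => [ik|ki]; last by lia.
  by exfalso; apply: iI; exists (absz (i + m%:Z)); rewrite /=; lia.
rewrite (@reindex_fsbig _ _ _ _ _ (fun i : nat => i%:Z - m%:Z) `I_k.+1); last first.
  split.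
  - by move=> i ik; exists i.
  - by move=> i j _ _ /= ij; lia.
  - by move=> _ [i ik <-]; exists i.
rewrite -fsbig_ord; apply: eq_bigr => -[i ik] _ /=.
rewrite !coef_poly (leq_trans ik)//.
rewrite (_ : (k - i < N)%N); last by lia.
by congr (_ * lcoef b _); lia.
Qed.

Lemma lconv_lt (a b : laurent) (m m' : nat) :
  (forall j, j < - m%:Z -> lcoef a j = 0) ->
  (forall j, j < - m'%:Z -> lcoef b j = 0) ->
  forall n, n < - (m + m')%:Z -> lconv a b n = 0.
Proof.
move=> am bm n nm; apply: fsbig1 => i _ /=.
case: (ltP i (- m%:Z)) => [/am ->|im]; first by rewrite mul0r.
by rewrite (bm (n - i)) ?mulr0//; lia.
Qed.

Fact laurentM_proof (a b : laurent) : laurent_set (lconv a b).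
Proof.
have [n abn] := lcoef_lb2 a b; apply/laurent_setP; exists (n + n)%N => j jn.
by apply: lconv_lt jn => i /abn[].
Qed.

Definition laurentM a b := Laurent (laurentM_proof a b).

Definition lmono_seq (n : int) (c : F) : int -> F := fun j => c *+ (j == n).

Fact lmono_proof n c : laurent_set (lmono_seq n c).
Proof.
apply/laurent_setP; exists `|n|%N => j jn; rewrite /lmono_seq.
by rewrite (_ : (j == n) = false)//; lia.
Qed.

Definition lmono n c := Laurent (lmono_proof n c).

Fact laurentMC : commutative laurentM.
Proof.
move=> a b; apply: laurentP => n; rewrite !lcoefE.
have [m am] := lcoef_lb a; have [m' bm'] := lcoef_lb b.
case: (ltP n (- (m + m')%:Z)) => nm.
  by rewrite (lconv_lt am bm')// (lconv_lt bm' am)//; lia.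
have [k ->] : exists k : nat, n = k%:Z - (m + m')%:Z.
  by exists (absz (n + (m + m')%:Z)); lia.
by rewrite (lconvE am bm' (leqnn _)) mulrC (addnC m) (lconvE bm' am (leqnn _)).
Qed.

Fact laurentMA : associative laurentM.
Proof.
have key a b c m : (forall j, j < - m%:Z -> lcoef a j = 0) ->
    (forall j, j < - m%:Z -> lcoef b j = 0) ->
    (forall j, j < - m%:Z -> lcoef c j = 0) -> forall k N, (k < N)%N ->
    lcoef (laurentM (laurentM a b) c) (k%:Z - (m + m + m)%:Z) =
    ((\poly_(i < N) lcoef a (i%:Z - m%:Z)) *
     (\poly_(i < N) lcoef b (i%:Z - m%:Z)) *
     (\poly_(i < N) lcoef c (i%:Z - m%:Z)))`_k.
  move=> am bm cm k N kN.
  have abm j : j < - (m + m)%:Z -> lcoef (laurentM a b) j = 0.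
    by move=> jm; exact: lconv_lt jm.
  rewrite lcoefE (lconvE abm cm kN) !coefM; apply: eq_bigr => -[i ik] _ /=.
  congr (_ * _); rewrite coef_poly (leq_trans ik)// lcoefE.
  by rewrite (lconvE am bm (leq_trans ik kN)).
move=> a b c; have [m1 am] := lcoef_lb a; have [m2 bcm] := lcoef_lb2 b c.
pose m := (m1 + m2)%N.
have {}am j : j < - m%:Z -> lcoef a j = 0 by move=> jm; apply: am; lia.
have bm j : j < - m%:Z -> lcoef b j = 0.
  by move=> jm; apply: (bcm _ _).1; lia.
have cm j : j < - m%:Z -> lcoef c j = 0.
  by move=> jm; apply: (bcm _ _).2; lia.
rewrite laurentMC; apply: laurentP => n.
case: (ltP n (- (m + m + m)%:Z)) => nm.
  by rewrite !lcoefE (@lconv_lt _ _ (m + m) m)// ?(@lconv_lt _ _ (m + m) m)//;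
    move=> j jm; exact: lconv_lt jm.
have [k ->] : exists k : nat, n = k%:Z - (m + m + m)%:Z.
  by exists (absz (n + (m + m + m)%:Z)); lia.
rewrite (key b c a _ bm cm am _ _ (leqnn _)) (key a b c _ am bm cm _ _ (leqnn _)).
by rewrite mulrC mulrA.
Qed.

Fact laurent1M : left_id (lmono 0 1) laurentM.
Proof.
have onem j : j < - 0%:Z -> lcoef (lmono 0 1) j = 0.
  by move=> j0; rewrite lcoefE /lmono_seq; case: eqP => // jE; lia.
move=> a; have [m am] := lcoef_lb a; apply: laurentP => n; rewrite lcoefE.
case: (ltP n (- (0 + m)%:Z)) => nm; first by rewrite (lconv_lt onem am)// am//; lia.
have [k ->] : exists k : nat, n = k%:Z - (0 + m)%:Z.
  by exists (absz (n + (0 + m)%:Z)); lia.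
rewrite (lconvE onem am (leqnn _)).
rewrite (_ : \poly_(i < _) _ = 1); last first.
  apply/polyP => i; rewrite coef_poly coef1 lcoefE /lmono_seq subr0.
  by case: i => [|i]//=; case: ifP.
by rewrite mul1r coef_poly leqnn; congr lcoef; lia.
Qed.

Fact laurentMDl : left_distributive laurentM +%R.
Proof.
move=> a b c; have [m abm] := lcoef_lb2 a b; have [m' cm] := lcoef_lb c.
have am j : j < - m%:Z -> lcoef a j = 0 by move=> /abm[].
have bm j : j < - m%:Z -> lcoef b j = 0 by move=> /abm[].
have sm j : j < - m%:Z -> lcoef (a + b) j = 0.
  by move=> /abm[]; rewrite lcoefD => -> ->; rewrite addr0.
apply: laurentP => n; rewrite lcoefD !lcoefE.
case: (ltP n (- (m + m')%:Z)) => nm.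
  by rewrite (lconv_lt sm cm)// (lconv_lt am cm)// (lconv_lt bm cm)// addr0.
have [k ->] : exists k : nat, n = k%:Z - (m + m')%:Z.
  by exists (absz (n + (m + m')%:Z)); lia.
rewrite (lconvE sm cm (leqnn _)) (lconvE am cm (leqnn _)) (lconvE bm cm (leqnn _)).
rewrite -coefD -mulrDl; congr ((polyseq (_ * _))`_ _); apply/polyP => i.
by rewrite coefD !coef_poly; case: ifP => // _; rewrite addr0.
Qed.

Fact laurent1_neq0 : lmono 0 1 != 0.
Proof.
apply/eqP => /(congr1 (lcoef^~ 0)); rewrite lcoefE lcoef0 /lmono_seq eqxx.
by move/eqP; rewrite oner_eq0.
Qed.

HB.instance Definition _ := GRing.Zmodule_isComNzRing.Build laurent
  laurentMA laurentMC laurent1M laurentMDl laurent1_neq0.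

(* [lg n] is g_n: the unit vector (1, 0, ..., 0) of GF(p^s), i.e. 1, at position
   n *)
Definition lg (n : int) : laurent := lmono n 1.

(* the compact open subgroup K_n *)
Definition lball (n : int) : set laurent :=
  [set a | forall j, j < n -> lcoef a j = 0].

Lemma lball_sub m n : m <= n -> lball n `<=` lball m.
Proof. by move=> mn a an j jm; apply: an; apply: lt_le_trans mn. Qed.

Lemma lball0 n : lball n 0. Proof. by []. Qed.

Lemma lballB n a b : lball n a -> lball n b -> lball n (a - b).
Proof. by move=> an bn j jn; rewrite lcoefB an// bn// subr0. Qed.

Lemma lballD n a b : lball n a -> lball n b -> lball n (a + b).
Proof. by move=> an bn j jn; rewrite lcoefD an// bn// addr0. Qed.

Definition laurent_nbhs (a : laurent) : set_system laurent :=
  [set U | exists n, [set b | lball n (b - a)] `<=` U].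

Fact laurent_nbhs_filter a : ProperFilter (laurent_nbhs a).
Proof.
split; first by case=> n /(_ a); apply; rewrite /= subrr.
split.
- by exists 0.
- move=> U V [n nU] [m mV]; exists (Num.max n m) => b /= bnm; split.
    by apply: nU; apply: lball_sub bnm; rewrite le_max lexx.
  by apply: mV; apply: lball_sub bnm; rewrite le_max lexx orbT.
- by move=> U V UV [n nU]; exists n; exact: subset_trans UV.
Qed.

Fact laurent_nbhs_singleton a U : laurent_nbhs a U -> U a.
Proof. by case=> n; apply; rewrite /= subrr. Qed.

Fact laurent_nbhs_nbhs a U :
  laurent_nbhs a U -> laurent_nbhs a (laurent_nbhs^~ U).
Proof.
case=> n nU; exists n => b /= ba; exists n => c /= cb; apply: nU => /=.
by rewrite -(subrKA b); exact: lballD.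
Qed.

HB.instance Definition _ := hasNbhs.Build laurent laurent_nbhs.
HB.instance Definition _ := Nbhs_isNbhsTopological.Build laurent
  laurent_nbhs_filter laurent_nbhs_singleton laurent_nbhs_nbhs.

Fact laurent_sub_continuous :
  continuous (fun x : laurent * laurent => x.1 - x.2).
Proof.
move=> [a b] U [n nU].
exists ([set c | lball n (c - a)], [set c | lball n (c - b)]) => /=.
  by split; exists n.
move=> [c d] /= [ca db]; apply: nU => /=.
rewrite (_ : c - d - (a - b) = (c - a) - (d - b)); first exact: lballB.
by rewrite !opprB addrACA [RHS]addrACA [- d - a]addrC.
Qed.

HB.instance Definition _ :=
  PreTopologicalNmodule_isTopologicalZmodule.Build laurent laurent_sub_continuous.
HB.instance Definition _ := isPointed.Build laurent 0.

End laurent_def.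

Arguments lg {F} n.
Arguments lball {F} n.

Notation borel T := (g_sigma_algebraType (@open T)).

Section haar_def.
Local Open Scope ereal_scope.
Context {R : realType} {T : ptopologicalType}.

(* nonzero, translation-invariant (for the commutative operation [mul]) and
   Radon *)
Definition is_haar (mul : T -> T -> T)
    (mu : {measure set (borel T) -> \bar R}) : Prop :=
  [/\ mu [set: borel T] != 0,
      forall (x : T) (A : set (borel T)), measurable A ->
        mu [set mul x y | y in A] = mu A,
      forall C : set T, compact C -> mu C < +oo,
      forall A : set (borel T), measurable A ->
        mu A = ereal_inf [set mu U | U in [set U : set T | open U /\ A `<=` U]]
    & forall U : set T, open U ->
        mu U = ereal_sup [set mu C | C in [set C : set T | compact C /\ C `<=` U]]].

End haar_def.

Section complex_integration.
Context d {T : measurableType d} {R : realType}.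
Variable mu : {measure set T -> \bar R}.
Local Open Scope ereal_scope.

(* Borel measurability of a complex function, coordinatewise *)
Definition cmeasurable (f : T -> R[i]) : Prop :=
  measurable_fun setT (fun x => complex.Re (f x)) /\
  measurable_fun setT (fun x => complex.Im (f x)).

Definition cintegral (f : T -> R[i]) : R[i] :=
  (Rintegral mu setT (fun x => complex.Re (f x))) +i*
  (Rintegral mu setT (fun x => complex.Im (f x))).

Definition cLnorm (q : \bar R) (f : T -> R[i]) : \bar R :=
  Lnorm mu q (fun x => (normc (f x))%:E).

Definition in_L1 (f : T -> R[i]) : Prop := cmeasurable f /\ cLnorm 1 f < +oo.
Definition in_L2 (f : T -> R[i]) : Prop :=
  cmeasurable f /\ cLnorm 2%:E f < +oo.

Definition L2_cvg (u : nat -> T -> R[i]) (f : T -> R[i]) : Prop :=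
  cLnorm 2%:E (fun x => u n x - f x)%R @[n --> \oo] --> 0.

Definition L2_inner (f g : T -> R[i]) : R[i] :=
  cintegral (fun x => f x * (g x)^*)%R.

Definition orthonormal_system {I : choiceType} (H : set I)
    (e : I -> T -> R[i]) : Prop :=
  (forall h, H h -> in_L2 (e h)) /\
  (forall h k, H h -> H k -> L2_inner (e h) (e k) = (h == k)%:R%R).

End complex_integration.

Section character_def.
Variables (R : realType) (G : topologicalZmodType).

Definition is_character (chi : G -> R[i]) : Prop :=
  [/\ continuous (chi : G -> R[i]^o),
      forall x, `|chi x| = 1
    & forall x y, chi (x + y) = chi x * chi y].

Definition character_set : set {compact-open, G -> R[i]^o} := is_character.

Definition character : Type := set_type character_set.

HB.instance Definition _ := gen_eqMixin character.
HB.instance Definition _ := gen_choiceMixin character.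
HB.instance Definition _ := Topological.copy character
  (@initial_topology character {compact-open, G -> R[i]^o} set_val).

Definition cval (chi : character) : G -> R[i] := set_val chi.

Definition Character (chi : G -> R[i]) (hchi : is_character chi) : character :=
  SigSub (mem_set (hchi : character_set chi)).

Lemma cvalE chi h : cval (@Character chi h) = chi. Proof. by []. Qed.

Lemma characterP (chi psi : character) : cval chi =1 cval psi -> chi = psi.
Proof. by move=> e; apply/val_inj/funext. Qed.

Lemma cvalP (chi : character) : is_character (cval chi).
Proof. exact: set_valP. Qed.

Lemma norm_cval (chi : character) x : `|cval chi x| = 1.
Proof. by have [_ ->] := cvalP chi. Qed.

Lemma cval_neq0 (chi : character) x : cval chi x != 0.
Proof. by rewrite -normr_eq0 norm_cval oner_eq0. Qed.

Lemma cvalD (chi : character) x y : cval chi (x + y) = cval chi x * cval chi y.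
Proof. by have [_ _ ->] := cvalP chi. Qed.

Fact char1_proof : is_character (fun=> 1).
Proof.
by split=> [x|x|x y]; [exact: cvg_cst|rewrite normr1|rewrite mulr1].
Qed.

Fact charM_proof (chi psi : character) :
  is_character (fun x => cval chi x * cval psi x).
Proof.
have [cchi _ _] := cvalP chi; have [cpsi _ _] := cvalP psi.
split=> [x|x|x y].
- by apply: cvgM; [exact: cchi|exact: cpsi].
- by rewrite normrM !norm_cval mulr1.
- by rewrite !cvalD mulrACA.
Qed.

Fact charV_proof (chi : character) : is_character (fun x => (cval chi x)^-1).
Proof.
have [cchi _ _] := cvalP chi.
split=> [x|x|x y].
- by apply: cvgV; [exact: cval_neq0|exact: cchi].
- by rewrite normfV norm_cval invr1.
- by rewrite cvalD invfM.
Qed.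

Definition char1 := Character char1_proof.
Definition charM chi psi := Character (charM_proof chi psi).
Definition charV chi := Character (charV_proof chi).

Fact charMA : associative charM.
Proof. by move=> a b c; apply: characterP => x; rewrite /charM !cvalE mulrA. Qed.
Fact char1M : left_id char1 charM.
Proof. by move=> a; apply: characterP => x; rewrite /charM !cvalE mul1r. Qed.
Fact charM1 : right_id char1 charM.
Proof. by move=> a; apply: characterP => x; rewrite /charM !cvalE mulr1. Qed.
Fact charVM : left_inverse char1 charV charM.
Proof.
by move=> a; apply: characterP => x; rewrite /charM !cvalE mulVf// cval_neq0.
Qed.
Fact charMV : right_inverse char1 charV charM.
Proof.
by move=> a; apply: characterP => x; rewrite /charM !cvalE mulfV// cval_neq0.
Qed.

HB.instance Definition _ := isGroup.Build character
  charMA char1M charM1 charVM charMV.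
HB.instance Definition _ := isPointed.Build character char1.

Definition annihilator (A : set G) : set character :=
  [set chi | forall x, A x -> cval chi x = 1].

End character_def.

Section fourier_def.
Context {R : realType} {F : fieldType}.
Local Notation K := (laurent F).
Local Notation X := (character R K).
Variables (mu : {measure set (borel K) -> \bar R}).
Variables (nu : {measure set (borel X) -> \bar R}).

Definition fourier (phi : K -> R[i]) : X -> R[i] :=
  fun chi => cintegral mu (fun x => phi x * (cval chi x)^* ).

(* [psi] is a representative of the image of [phi] under the extension by
   continuity of [fourier] from L1 /\ L2 to L2 *)
Definition fourier_L2 (phi : K -> R[i]) (psi : X -> R[i]) : Prop :=
  in_L2 mu phi /\ in_L2 nu psi /\
  exists u : nat -> K -> R[i],
    [/\ forall n, in_L1 mu (u n) /\ in_L2 mu (u n),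
        L2_cvg mu u phi
      & L2_cvg nu (fun n => fourier (u n)) psi].

End fourier_def.

Section expi.
Variable R : realType.

Definition expi (t : R) : R[i] := cos t +i* sin t.

Lemma expi0 : expi 0 = 1.
Proof. by rewrite /expi cos0 sin0. Qed.

Lemma expiD a b : expi (a + b) = expi a * expi b.
Proof. by rewrite /expi cosD sinD; simpc; congr (_ +i* _); rewrite addrC. Qed.

Lemma norm_expi t : `|expi t| = 1.
Proof. by rewrite normc_def /= cos2Dsin2 sqrtr1. Qed.

Lemma expi2piMn n : expi (2 * pi * n%:R) = 1.
Proof.
elim: n => [|n IHn]; first by rewrite mulr0 expi0.
rewrite -[n.+1%:R]natr1 mulrDr mulr1 expiD IHn mul1r /expi.
by rewrite mulr_natl cos2pi sin2pi.
Qed.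

Lemma expi_modn p m n : (0 < p)%N -> (m = n %[mod p])%N ->
  expi (2 * pi / p%:R * m%:R) = expi (2 * pi / p%:R * n%:R).
Proof.
move=> p0; suff key k : expi (2 * pi / p%:R * k%:R) =
    expi (2 * pi / p%:R * (k %% p)%:R) by rewrite key => ->; rewrite -key.
rewrite [in LHS](divn_eq k p) natrD mulrDr expiD natrM mulrA mulrAC.
by rewrite mulrVK ?unitfE ?pnatr_eq0 -?lt0n// expi2piMn mul1r.
Qed.

End expi.

(* K = F^(s), over GF(p^s) = 'F_p[t] / (f).  The quotient depends on the
   irreducible polynomial f only up to a nonzero scalar, hence the
   normalization f monic required by the library; the argument of [laurent] is
   the field structure of [{poly %/ f with f_irr}]. *)
Notation laurentGF f_irr :=
  (laurent (qfpoly_qfpoly__canonical__GRing_Field f_irr)).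

Section GF_characters.
Variables (R : realType) (p s : nat) (p_prime : prime p).
Variables (f : {poly 'F_p}) (f_irr : monic_irreducible_poly f).

(* GF(p^s) when [size f = s.+1]: the vector (a^(0), ..., a^(s-1)) is the
   polynomial [a], with coefficients [a`_0, ..., a`_(s-1)] *)
Local Notation GF := {poly %/ f with f_irr}.
Local Notation K := (laurentGF f_irr).
Local Notation X := (character R K).

Definition gcoord (u : GF) (l : nat) : nat :=
  nat_of_ord (((polyn u)`_l)%R : 'F_p).

Lemma gcoordD u v l : gcoord (u + v) l = ((gcoord u l + gcoord v l) %% p)%N.
Proof.
rewrite /gcoord (_ : polyn (u + v) = polyn u + polyn v)// coefD /=.
by rewrite [X in (_ %% X)%N](@Fp_cast p).
Qed.

Definition rchar_fun (k : int) (u : GF) (x : K) : R[i] :=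
  \prod_(l < s)
    expi (2 * pi / p%:R * (gcoord u l * gcoord (lcoef x k) l)%:R).

Fact rchar_proof k u : is_character (rchar_fun k u).
Proof.
split=> [x|x|x y].
- have xk : \forall y \near x, rchar_fun k u y = rchar_fun k u x.
    exists (k + 1) => y /= yx; rewrite /rchar_fun.
    suff -> : lcoef y k = lcoef x k by [].
    by apply/eqP; rewrite -subr_eq0 -lcoefB yx// ltrDl.
  exact: (@cvg_near_cst K R[i]^o _ _ (nbhs x) (nbhs_filter x) xk).
- by rewrite /rchar_fun normr_prod big1//= => l _; rewrite norm_expi.
- rewrite /rchar_fun -big_split/=; apply: eq_bigr => l _.
  rewrite -expiD -mulrDr -natrD -mulnDr; apply: expi_modn.
    exact: prime_gt0.
  by rewrite lcoefD gcoordD modnMmr.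
Qed.

Definition rchar (k : int) (u : GF) : X := Character (rchar_proof k u).

Definition H0 : set K :=
  [set h | exists l : nat, (0 < l)%N /\ exists a : nat -> GF,
    h = \sum_(1 <= j < l.+1) a j *: lg (- j%:Z)].

Definition Kperp (n : int) : set X := annihilator (lball n : set K).

Definition char_coset (A : set X) (chi : X) : set X :=
  [set (psi * chi)%g | psi in A].

(* [alpha j l] and [beta j l] are the vectors alpha_{-N+l} and alpha_l attached
   to the index j *)
Definition elementary_set (N M : nat) (E : set X) : Prop :=
  exists alpha beta : nat -> nat -> GF,
  let J := `I_(p ^ (s * N)) in
  let xi j := (\prod_(l < N) rchar (- N%:Z + l%:Z) (alpha j l))%g in
  let eta j := (\prod_(l < M) rchar l%:Z (beta j l))%g in
  let zeta j := (xi j * eta j)%g in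
  [/\ forall j, J j -> j =
        (\sum_(l < N) (\sum_(i < s) gcoord (alpha j l) i * p ^ i) * p ^ (s * l))%N,
      trivIset J (fun j => char_coset (Kperp (- N%:Z)) (zeta j)) /\
      E = \bigcup_(j in J) char_coset (Kperp (- N%:Z)) (zeta j),
      trivIset J (fun j => char_coset (Kperp (- N%:Z)) (xi j)) /\
      \bigcup_(j in J) char_coset (Kperp (- N%:Z)) (xi j) = Kperp 0,
      char_coset (Kperp (- N%:Z)) (xi 0%N) = Kperp (- N%:Z)
    & forall l : nat, (l < M + N)%N ->
        (Kperp (- N%:Z + l%:Z + 1) `\` Kperp (- N%:Z + l%:Z)) `&` E !=set0].

End GF_characters.

Arguments Kperp R {p f} f_irr n.
Arguments H0 {p f} f_irr.

(* Main.v *)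
Require Import Defs.
From HB Require Import structures.
From mathcomp Require Import all_boot all_order all_algebra all_fingroup all_field.
From mathcomp Require Import all_classical all_reals all_analysis.
From mathcomp Require Import complex.
From mathcomp Require Import measurable_realfun zify ring lra.

Set Implicit Arguments.
Unset Strict Implicit.
Unset Printing Implicit Defensive.

Import Order.TTheory GRing.Theory Num.Theory.
Import numFieldNormedType.Exports.
Import ComplexField.Normc.

Local Open Scope classical_set_scope.
Local Open Scope ring_scope.
Local Open Scope complex_scope.
(* the same conjugation as in complex scope, where ring scope has the convertible
   one of closed fields *)
Local Notation "z ^*" := (conjc z) : ring_scope.

(** By Plancherel's formula, the inner product of [phi(x - h)] and [phi(x - k)]
   is the integral of [|phihat|^2 * chi(k - h) = 1_E * chi(k - h)] over the
   character group. The set [E] consists of cosets of the annihilator of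
   [K_{-N}], with representatives [xi_j * eta_j]. The factors [eta_j] only
   involve coordinates of nonnegative index, which vanish on [H_0], and by
   translation invariance the integral of [chi(k - h)] over a coset only depends
   on the value of the representative at [k - h]. So nothing changes when [eta_j]
   is dropped, and then the cosets fill up the annihilator of [K_0]. There a
   character integrates to zero unless it is trivial, i.e. unless [k - h] lies in
   [K_0], which for elements of [H_0] means [h = k]; the value is then the volume
   of the annihilator of [K_0], that is 1.

   Instead of Plancherel's theorem for all square-integrable functions, the proof
   uses that [phihat], having modulus [1_E] with [E] of finite measure, is also
   integrable. The engine is the multiplication formula
   [int u^ * g = int u * (int conj (chi(x)) * g(chi))] for integrable [u] and [g]
   ([multiplication_formula]), an instance of Fubini's theorem. Applied to
   indicators of balls and of annihilators, for which both transforms are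
   computed by orthogonality, it yields first that the volumes of [K_n] and of
   its annihilator are inverse to each other ([mu_lball_nu_perp]), and then, after
   passing to the limit in the sequence that defines [phihat], that [phi] and the
   inverse transform of [phihat] have the same integral over each ball
   ([fourier_L2_ball]). As the balls generate the Borel sets, the two functions
   agree almost everywhere ([ae_eq_balls]). One more application, to the
   approximating sequence of [phi] and to the conjugate of [phihat], identifies
   the correlations of [phi] with the transform of [|phihat|^2]
   ([fourier_correlation]).

   The measure theory rests on two finiteness facts. The residue field is finite,
   so balls split into finitely many smaller balls, and there are countably many
   balls in all. The additive group has exponent [p], so characters take values
   among the [p]-th roots of unity; hence each of them is trivial on some [K_n],
   and the annihilators of the [K_n] have finite measure and exhaust the
   character group. *)

(** * Complex numbers and integrals of complex functions *)

Section complex_facts.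
Context {R : realType}.
Implicit Types z w : R[i].

Lemma cReM z w : complex.Re (z * w) =
  complex.Re z * complex.Re w - complex.Im z * complex.Im w.
Proof. by case: z => a b; case: w => c d. Qed.

Lemma cImM z w : complex.Im (z * w) =
  complex.Re z * complex.Im w + complex.Im z * complex.Re w.
Proof. by case: z => a b; case: w => c d. Qed.

Lemma cReD z w : complex.Re (z + w) = complex.Re z + complex.Re w.
Proof. by case: z => a b; case: w => c d. Qed.

Lemma cImD z w : complex.Im (z + w) = complex.Im z + complex.Im w.
Proof. by case: z => a b; case: w => c d. Qed.

Lemma cReN z : complex.Re (- z) = - complex.Re z.
Proof. by case: z. Qed.

Lemma cImN z : complex.Im (- z) = - complex.Im z.
Proof. by case: z. Qed.

Lemma cReJ z : complex.Re z^* = complex.Re z.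
Proof. by case: z. Qed.

Lemma cImJ z : complex.Im z^* = - complex.Im z.
Proof. by case: z. Qed.

Lemma conjcM z w : (z * w)^* = z^* * w^*.
Proof. exact: rmorphM. Qed.

Lemma conjcR (a : R) : a%:C^* = a%:C.
Proof. by rewrite /= oppr0. Qed.

Lemma conjc_one : (1 : R[i])^* = 1.
Proof. exact: conjc1. Qed.

Lemma real_complexM (a b : R) : (a * b)%:C = a%:C * b%:C.
Proof. exact: rmorphM. Qed.

Lemma normc_sqrt z :
  normc z = Num.sqrt (complex.Re z ^+ 2 + complex.Im z ^+ 2).
Proof. by case: z. Qed.

Lemma normc_ge0 z : 0 <= normc z.
Proof. by rewrite normc_sqrt sqrtr_ge0. Qed.

Lemma normc_conj z : normc z^* = normc z.
Proof. by case: z => a b /=; rewrite sqrrN. Qed.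

Lemma normc_normr z : `|z| = (normc z)%:C.
Proof. by case: z. Qed.

Lemma normc_eq1 z : `|z| = 1 -> normc z = 1.
Proof. by rewrite normc_normr => /eqP; rewrite eq_complex => /andP[/eqP]. Qed.

Lemma ler_Re_normc z : `|complex.Re z| <= normc z.
Proof. by rewrite -sqrtr_sqr normc_sqrt ler_wsqrtr// lerDl sqr_ge0. Qed.

Lemma ler_Im_normc z : `|complex.Im z| <= normc z.
Proof. by rewrite -sqrtr_sqr normc_sqrt ler_wsqrtr// lerDr sqr_ge0. Qed.

Lemma normc_leD z w : normc (z + w) <= normc z + normc w.
Proof. exact: le_normcD. Qed.

Lemma normc_le_ReIm z : normc z <= `|complex.Re z| + `|complex.Im z|.
Proof.
case: z => a b; rewrite -[leLHS]ger0_norm ?normc_ge0// -ler_sqr ?nnegrE//.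
rewrite ger0_norm ?normc_ge0//= sqr_sqrtr ?addr_ge0 ?sqr_ge0//.
rewrite sqrrD !real_normK ?num_real// addrAC lerDl.
by rewrite mulrn_wge0// mulr_ge0.
Qed.

Lemma mulc_conj z : z * z^* = (normc z ^+ 2)%:C.
Proof.
by rewrite normc_sqrt sqr_sqrtr ?addr_ge0 ?sqr_ge0//; case: z => a b; simpc;
  congr (_ +i* _); ring.
Qed.

Lemma normc_real (a : R) : normc a%:C = `|a|.
Proof. by rewrite /= expr0n addr0 sqrtr_sqr. Qed.

End complex_facts.

Section complex_integral.
Context d {T : measurableType d} {R : realType}.
Variable mu : {measure set T -> \bar R}.
Implicit Types f g : T -> R[i].

Lemma cmeasurable_cst (c : R[i]) : cmeasurable (fun _ : T => c).
Proof. by split; exact: measurable_cst. Qed.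

Lemma cmeasurableM f g : cmeasurable f -> cmeasurable g ->
  cmeasurable (fun x => f x * g x).
Proof.
move=> [f1 f2] [g1 g2]; split.
  under eq_fun do rewrite cReM.
  by apply: measurable_funB; exact: measurable_funM.
under eq_fun do rewrite cImM.
by apply: measurable_funD; exact: measurable_funM.
Qed.

Lemma cmeasurableD f g : cmeasurable f -> cmeasurable g ->
  cmeasurable (fun x => f x + g x).
Proof.
move=> [f1 f2] [g1 g2]; split.
  by under eq_fun do rewrite cReD; exact: measurable_funD.
by under eq_fun do rewrite cImD; exact: measurable_funD.
Qed.

Lemma cmeasurableN f : cmeasurable f -> cmeasurable (fun x => - f x).
Proof.
move=> [f1 f2]; split.
  by under eq_fun do rewrite cReN; exact: measurableT_comp.
by under eq_fun do rewrite cImN; exact: measurableT_comp.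
Qed.

Lemma cmeasurableB f g : cmeasurable f -> cmeasurable g ->
  cmeasurable (fun x => f x - g x).
Proof. by move=> mf mg; apply: cmeasurableD => //; exact: cmeasurableN. Qed.

Lemma cmeasurableJ f : cmeasurable f -> cmeasurable (fun x => (f x)^*).
Proof.
move=> [f1 f2]; split; first by under eq_fun do rewrite cReJ.
by under eq_fun do rewrite cImJ; exact: measurableT_comp.
Qed.

Lemma cmeasurable_real (f : T -> R) : measurable_fun setT f ->
  cmeasurable (fun x => (f x)%:C).
Proof. by move=> mf; split=> //; exact: measurable_cst. Qed.

Lemma cmeasurable_indic (A : set T) : measurable A ->
  cmeasurable (fun x => (\1_A x : R)%:C).
Proof. by move=> mA; apply: cmeasurable_real; exact: measurable_indic. Qed.

Lemma measurable_normc f : cmeasurable f ->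
  measurable_fun setT (fun x => normc (f x)).
Proof.
move=> [f1 f2]; under eq_fun do rewrite normc_sqrt.
have mp := measurable_powR (2^-1 : R); rewrite (_ : (fun x => _) =
  (fun x => (complex.Re (f x) ^+ 2 + complex.Im (f x) ^+ 2) `^ 2^-1));
    last first.
  by apply/funext => x; rewrite powR12_sqrt// addr_ge0// sqr_ge0.
apply: (measurableT_comp mp); apply: measurable_funD; exact: measurable_funX.
Qed.

Lemma cLnorm1E f : cLnorm mu 1 f = (\int[mu]_x (normc (f x))%:E)%E.
Proof.
rewrite /cLnorm Lnorm1; apply: eq_integral => x _.
by rewrite gee0_abs// lee_fin normc_ge0.
Qed.

(** Reduces complex integrability to that of two real functions, to which the
   linearity of the real integral applies. *)
Lemma in_L1P f : in_L1 mu f <->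
  mu.-integrable setT (fun x => (complex.Re (f x))%:E) /\
  mu.-integrable setT (fun x => (complex.Im (f x))%:E).
Proof.
rewrite /in_L1 cLnorm1E; split=> [[[f1 f2] fi]|[i1 i2]].
  have mn : measurable_fun setT (fun x => normc (f x)) by exact:
    measurable_normc.
  have ni : mu.-integrable setT (fun x => (normc (f x))%:E).
    apply/integrableP; split; first exact/measurable_EFinP.
    by under eq_integral do rewrite gee0_abs ?lee_fin ?normc_ge0//.
  split; apply: (le_integrable _ _ _ ni) => //; try exact/measurable_EFinP.
    by move=> x _ /=; rewrite lee_fin (ger0_norm (normc_ge0 _)) ler_Re_normc.
  by move=> x _ /=; rewrite lee_fin (ger0_norm (normc_ge0 _)) ler_Im_normc.
have mf : cmeasurable f.
  by split; apply/measurable_EFinP;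
    [exact: measurable_int i1|exact: measurable_int i2].
split=> //.
have si := integrableD measurableT (integrable_abse i1) (integrable_abse i2).
move/integrableP : si => [ms]; apply: le_lt_trans.
apply: ge0_le_integral => //.
- by move=> x _; rewrite lee_fin normc_ge0.
- by apply/measurable_EFinP; exact: measurable_normc.
- exact: measurableT_comp.
- by move=> x _ /=; rewrite lee_fin [leRHS]ger0_norm ?addr_ge0// normc_le_ReIm.
Qed.

Lemma in_L1_le f g : cmeasurable f -> in_L1 mu g ->
  (forall x, normc (f x) <= normc (g x)) -> in_L1 mu f.
Proof.
move=> mf [mg gi] fg; split => //; apply: le_lt_trans gi.
rewrite !cLnorm1E; apply: ge0_le_integral => //.
- by move=> x _; rewrite lee_fin normc_ge0.
- by apply/measurable_EFinP; exact: measurable_normc.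
- by apply/measurable_EFinP; exact: measurable_normc.
- by move=> x _; rewrite lee_fin.
Qed.

Lemma in_L1D f g : in_L1 mu f -> in_L1 mu g -> in_L1 mu (fun x => f x + g x).
Proof.
move=> /in_L1P[f1 f2] /in_L1P[g1 g2]; apply/in_L1P; split.
  by under eq_fun do rewrite cReD EFinD; exact: integrableD.
by under eq_fun do rewrite cImD EFinD; exact: integrableD.
Qed.

Lemma in_L1J f : in_L1 mu f -> in_L1 mu (fun x => (f x)^*).
Proof.
move=> fi; apply: (in_L1_le _ fi); first exact/cmeasurableJ/fi.1.
by move=> x; rewrite normc_conj.
Qed.

Lemma in_L1Zl (c : R[i]) f : in_L1 mu f -> in_L1 mu (fun x => c * f x).
Proof.
move=> [mf fi]; split; first by apply: cmeasurableM => //;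
  exact: cmeasurable_cst.
rewrite cLnorm1E; under eq_integral do rewrite normcM EFinM.
rewrite ge0_integralZl//.
- by apply: lte_mul_pinfty; rewrite ?lee_fin ?normc_ge0// -cLnorm1E.
- by apply/measurable_EFinP; exact: measurable_normc.
- by move=> x _; rewrite lee_fin normc_ge0.
- by rewrite lee_fin normc_ge0.
Qed.

Lemma in_L1N f : in_L1 mu f -> in_L1 mu (fun x => - f x).
Proof. by move=> /(in_L1Zl (-1)); under eq_fun do rewrite mulN1r. Qed.

Lemma cintegralD f g : in_L1 mu f -> in_L1 mu g ->
  cintegral mu (fun x => f x + g x) = cintegral mu f + cintegral mu g.
Proof.
move=> /in_L1P[f1 f2] /in_L1P[g1 g2]; rewrite /cintegral; simpc.
by congr (_ +i* _); rewrite -RintegralD//; apply: eq_Rintegral => x _;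
  rewrite ?cReD ?cImD.
Qed.

Lemma cintegralZl (c : R[i]) f : in_L1 mu f ->
  cintegral mu (fun x => c * f x) = c * cintegral mu f.
Proof.
move=> /in_L1P[f1 f2]; case: c => a b; rewrite /cintegral.
have sc (k : R) h : mu.-integrable setT (fun x => (h x)%:E) ->
    mu.-integrable setT (fun x => (k * h x)%:E).
  by move=> hi; under eq_fun do rewrite EFinM; exact: integrableZl.
simpc; congr (_ +i* _).
  rewrite -!RintegralZl// -RintegralB//; try exact: sc.
  by apply: eq_Rintegral => x _; rewrite cReM.
rewrite -!RintegralZl// -RintegralD//; try exact: sc.
by apply: eq_Rintegral => x _; rewrite cImM.
Qed.

Lemma cintegralN f : in_L1 mu f ->
  cintegral mu (fun x => - f x) = - cintegral mu f.
Proof.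
move=> fi; rewrite -mulN1r -cintegralZl//.
by congr cintegral; apply/funext => x; rewrite mulN1r.
Qed.

Lemma cintegralB f g : in_L1 mu f -> in_L1 mu g ->
  cintegral mu (fun x => f x - g x) = cintegral mu f - cintegral mu g.
Proof. by move=> fi gi; rewrite cintegralD// ?cintegralN//; exact: in_L1N. Qed.

Lemma cintegralJ f : in_L1 mu f ->
  cintegral mu (fun x => (f x)^*) = (cintegral mu f)^*.
Proof.
move=> /in_L1P[f1 f2]; rewrite /cintegral /=; congr (_ +i* _).
  by apply: eq_Rintegral => x _; rewrite cReJ.
under eq_Rintegral do rewrite cImJ -mulN1r.
by rewrite RintegralZl// mulN1r.
Qed.

Lemma eq_cintegral f g : f =1 g -> cintegral mu f = cintegral mu g.
Proof. by move=> /funext ->. Qed.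

Lemma ae_eq_cintegral f g : cmeasurable f -> cmeasurable g ->
  {ae mu, forall x, f x = g x} -> cintegral mu f = cintegral mu g.
Proof.
move=> [f1 f2] [g1 g2] fg; rewrite /cintegral /Rintegral;
  congr (fine _ +i* fine _).
  apply: ae_eq_integral => //; try exact/measurable_EFinP.
  by apply: filterS fg => x -> _.
apply: ae_eq_integral => //; try exact/measurable_EFinP.
by apply: filterS fg => x -> _.
Qed.

(** The real and imaginary parts are bounded separately, whence the constant 2,
   which is harmless in limits. *)
Lemma normc_cintegral f : in_L1 mu f ->
  ((normc (cintegral mu f))%:E <= 2%:E * cLnorm mu 1 f)%E.
Proof.
move=> fi; have [i1 i2] := (in_L1P f).1 fi.
have mn := measurable_normc fi.1.
have key h : mu.-integrable setT (fun x => (h x)%:E) ->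
    (forall x, `|h x| <= normc (f x)) ->
    (`|Rintegral mu setT h|%:E <= cLnorm mu 1 f)%E.
  move=> hi hf; have mh : measurable_fun setT h.
    by apply/measurable_EFinP; exact: measurable_int hi.
  rewrite EFin_normr_Rintegral//.
  apply: le_trans (le_abse_integral _ _ _) _ => //.
    by apply/measurable_EFinP.
  rewrite cLnorm1E; apply: ge0_le_integral => //.
  - by apply: measurableT_comp => //; apply/measurable_EFinP.
  - exact/measurable_EFinP.
  - by move=> x _; rewrite lee_fin.
apply: (@le_trans _ _ (`|Rintegral mu setT (fun x => complex.Re (f x))|%:E
    + `|Rintegral mu setT (fun x => complex.Im (f x))|%:E)%E).
  by rewrite -EFinD lee_fin; exact: (normc_le_ReIm (cintegral mu f)).
rewrite (_ : 2%:E = 1%:E + 1%:E)%E; last by rewrite -EFinD.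
rewrite ge0_muleDl ?lee_fin// !mul1e leeD//; apply: key => // x.
  exact: ler_Re_normc.
exact: ler_Im_normc.
Qed.

End complex_integral.

(** * Square-integrable functions *)

Section Hilbert_space_bounds.
Context d {T : measurableType d} {R : realType}.
Variable mu : {measure set T -> \bar R}.
Implicit Types f g : T -> R[i].

(** The inequality of Cauchy and Schwarz, from that of Hoelder for the moduli. *)
Lemma cLnorm1M f g : cmeasurable f -> cmeasurable g ->
  (cLnorm mu 1 (fun x => f x * g x)%R <= cLnorm mu 2%:E f * cLnorm mu 2%:E g)%E.
Proof.
move=> mf mg.
have -> : cLnorm mu 1 (fun x => f x * g x)%R =
    Lnorm mu 1 (EFin \o ((fun x => normc (f x)) \* (fun x => normc (g x)))%R).
  by apply: eq_Lnorm => x /=; rewrite normcM.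
by apply: hoelder => //; [exact: measurable_normc|exact: measurable_normc|lra].
Qed.

Lemma in_L2M f g : in_L2 mu f -> in_L2 mu g -> in_L1 mu (fun x => f x * g x).
Proof.
move=> [mf fi] [mg gi]; split; first exact: cmeasurableM.
apply: le_lt_trans (cLnorm1M mf mg) _.
by apply: lte_mul_pinfty => //;
  [exact: Lnorm_ge0|rewrite ge0_fin_numE// Lnorm_ge0].
Qed.

Lemma eq_cLnorm q f g : (forall x, normc (f x) = normc (g x)) ->
  cLnorm mu q f = cLnorm mu q g.
Proof. by move=> fg; apply: eq_Lnorm => x /=; rewrite fg. Qed.

Lemma in_L2_eqnorm f g : cmeasurable f -> in_L2 mu g ->
  (forall x, normc (f x) = normc (g x)) -> in_L2 mu f.
Proof. by move=> mf [_ gi] fg; split => //; rewrite (eq_cLnorm _ fg). Qed.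

Lemma in_L2P f : in_L2 mu f <->
  cmeasurable f /\ (\int[mu]_x (normc (f x) ^+ 2)%:E < +oo)%E.
Proof.
rewrite /in_L2; split => -[mf fi]; split => //.
  have := @powR_Lnorm _ _ _ mu (fun x => (normc (f x))%:E) 2 ltac:(by []).
  under [in RHS]eq_integral do
    rewrite gee0_abs ?lee_fin ?normc_ge0// poweR_EFin powR_mulrn ?normc_ge0//.
  by move=> <-; exact: poweR_lty.
rewrite /cLnorm unlock; apply: poweR_lty.
by under eq_integral do
    rewrite gee0_abs ?lee_fin ?normc_ge0// poweR_EFin powR_mulrn ?normc_ge0//.
Qed.

Lemma in_L2Zl (c : R[i]) f : in_L2 mu f -> in_L2 mu (fun x => c * f x).
Proof.
move=> /in_L2P[mf fi]; apply/in_L2P; split.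
  by apply: cmeasurableM => //; exact: cmeasurable_cst.
under eq_integral do rewrite normcM exprMn EFinM.
rewrite ge0_integralZl//.
- by apply: lte_mul_pinfty; rewrite ?lee_fin ?sqr_ge0.
- exact/measurable_EFinP/measurable_funX/measurable_normc.
- by move=> x _; rewrite lee_fin sqr_ge0.
- by rewrite lee_fin sqr_ge0.
Qed.

Lemma in_L2J f : in_L2 mu f -> in_L2 mu (fun x => (f x)^*).
Proof.
move=> fi; apply: (in_L2_eqnorm _ fi); first exact/cmeasurableJ/fi.1.
by move=> x; rewrite normc_conj.
Qed.

(** Convergence of complex numbers, in terms of the real-valued norm. *)
Definition ccvg (a : nat -> R[i]) (b : R[i]) : Prop :=
  normc (a n - b) @[n --> \oo] --> (0 : R).

Lemma ccvg_unique (a : nat -> R[i]) b c : ccvg a b -> ccvg a c -> b = c.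
Proof.
move=> ab ac; apply/eqP; rewrite -subr_eq0; apply/eqP/eq0_normc.
apply/eqP; rewrite eq_le normc_ge0 andbT.
have abc : normc (a n - b) + normc (a n - c) @[n --> \oo] --> (0 : R).
  by rewrite -[X in _ --> X]addr0; exact: cvgD ab ac.
rewrite -[leRHS](cvg_lim _ abc)//; apply: limr_ge; first by apply/cvg_ex;
  exists 0.
apply: nearW => n; rewrite -(normcN (a n - b)) opprB.
by apply: le_trans (normc_leD _ _); rewrite addrA subrK.
Qed.

(** By Cauchy and Schwarz, the integral against a fixed square-integrable [g] is
   continuous for the L2 norm. The terms of the sequence need not be
   square-integrable themselves: the lemma will be applied to Fourier transforms
   of integrable functions, which are known to be bounded only. *)
Lemma L2_cvg_cintegral (u : nat -> T -> R[i]) f g :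
  (forall n, cmeasurable (u n)) -> (forall n, in_L1 mu (fun x => u n x * g x))
    ->
  in_L2 mu f -> in_L2 mu g -> L2_cvg mu u f ->
  ccvg (fun n => cintegral mu (fun x => u n x * g x))
       (cintegral mu (fun x => f x * g x)).
Proof.
move=> u_meas ugi fi gi uf; rewrite /ccvg.
have gfin : cLnorm mu 2%:E g \is a fin_num.
  by rewrite ge0_fin_numE ?gi.2//; exact: Lnorm_ge0.
have bnd n : ((normc (cintegral mu (fun x => u n x * g x) -
       cintegral mu (fun x => f x * g x)))%:E <=
    2%:E * (cLnorm mu 2%:E (fun x => u n x - f x)%R * cLnorm mu 2%:E g))%E.
  rewrite -cintegralB; [|exact: ugi|exact: in_L2M].
  rewrite (eq_cintegral _ (g := fun x => (u n x - f x) * g x)); last first.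
    by move=> x; rewrite mulrBl.
  have mB : cmeasurable (fun x => u n x - f x).
    by apply: cmeasurableB; [exact: u_meas|exact: fi.1].
  have iB : in_L1 mu (fun x => (u n x - f x) * g x).
    under eq_fun do rewrite mulrBl.
    by apply: in_L1D; [exact: ugi|apply: in_L1N; exact: in_L2M].
  apply: le_trans (normc_cintegral iB) _.
  by rewrite lee_pmul2l//; apply: cLnorm1M; [exact: mB|exact: gi.1].
suff /fine_cvgP[] : (normc (cintegral mu (fun x => u n x * g x) -
    cintegral mu (fun x => f x * g x)))%:E @[n --> \oo] --> 0%:E by [].
apply: (@squeeze_cvge _ _ _ _ (fun=> 0%E) _
  (fun n => (2%:E * (cLnorm mu 2%:E (fun x =>
    u n x - f x)%R * cLnorm mu 2%:E g))%E)).
- by apply: nearW => n; rewrite bnd lee_fin normc_ge0.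
- exact: cvg_cst.
- rewrite (_ : 0%:E = (2%:E * (0 * cLnorm mu 2%:E g))%E); last first.
    by rewrite mul0e mule0.
  by apply: cvgeZl => //; exact: cvgeZr.
Qed.

End Hilbert_space_bounds.

(** * Measure-preserving maps and Fubini's theorem *)

Section measure_preserving.
Context d {T : measurableType d} {R : realType}.
Variables (mu : {measure set T -> \bar R}) (tau : T -> T).
Hypothesis mtau : measurable_fun setT tau.
Hypothesis tau_inv : forall A, measurable A -> mu (tau @^-1` A) = mu A.

Lemma ge0_integral_preserving (h : T -> \bar R) : measurable_fun setT h ->
  (forall x, 0 <= h x)%E -> (\int[mu]_x h (tau x) = \int[mu]_x h x)%E.
Proof.
move=> mh h0.
rewrite -[LHS](ge0_integral_pushforward mtau mu measurableT mh)//.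
by apply: eq_measure_integral => A mA _; exact: tau_inv.
Qed.

Lemma integral_preserving (h : T -> \bar R) : measurable_fun setT h ->
  (\int[mu]_x h (tau x) = \int[mu]_x h x)%E.
Proof.
move=> mh; rewrite integralE [in RHS]integralE.
rewrite -/(h \o tau); congr (_ - _)%E.
  under eq_integral do rewrite funepos_comp/=.
  apply: (ge0_integral_preserving (h := (h^\+)%E)) => //.
  exact: measurable_funepos.
under eq_integral do rewrite funeneg_comp/=.
apply: (ge0_integral_preserving (h := (h^\-)%E)) => //.
exact: measurable_funeneg.
Qed.

Lemma cmeasurable_preserving (f : T -> R[i]) : cmeasurable f ->
  cmeasurable (fun x => f (tau x)).
Proof. by move=> [f1 f2]; split;
  [exact: measurableT_comp f1 mtau|exact: measurableT_comp f2 mtau]. Qed.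

Lemma cintegral_preserving (f : T -> R[i]) : cmeasurable f ->
  cintegral mu (fun x => f (tau x)) = cintegral mu f.
Proof.
move=> [f1 f2]; rewrite /cintegral /Rintegral.
rewrite (integral_preserving (h := fun x => (complex.Re (f x))%:E));
  last exact/measurable_EFinP.
by rewrite (integral_preserving (h := fun x => (complex.Im (f x))%:E))//;
  exact/measurable_EFinP.
Qed.

Lemma cLnorm2_preserving (f : T -> R[i]) : cmeasurable f ->
  cLnorm mu 2%:E (fun x => f (tau x)) = cLnorm mu 2%:E f.
Proof.
move=> mf; rewrite /cLnorm unlock.
rewrite (ge0_integral_preserving (h := fun x =>
  (`| (normc (f x))%:E | `^ 2)%E))//; last first.
  by move=> x; rewrite poweR_ge0.
  under eq_fun do rewrite gee0_abs ?lee_fin ?normc_ge0// poweR_EFin powR_mulrn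
    ?normc_ge0//.
by apply/measurable_EFinP/measurable_funX/measurable_normc.
Qed.

Lemma in_L2_preserving (f : T -> R[i]) : in_L2 mu f ->
  in_L2 mu (fun x => f (tau x)).
Proof.
move=> [mf fi]; split; first exact: cmeasurable_preserving.
by rewrite cLnorm2_preserving.
Qed.

Lemma ae_preserving (P : T -> Prop) :
  {ae mu, forall x, P x} -> {ae mu, forall x, P (tau x)}.
Proof.
move=> [N [mN N0 PN]]; exists (tau @^-1` N); split.
- by rewrite -[X in measurable X]setTI; exact: mtau.
- by rewrite tau_inv.
- by move=> x /= Px; apply: PN.
Qed.

End measure_preserving.

Section sigma_finite_bundle.
Context d {T : measurableType d} {R : realType}.
Variable mu : {measure set T -> \bar R}.
Hypothesis mu_sigma_finite : sigma_finite setT mu.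

(** The proof of sigma-finiteness is an argument, so that it can be recovered
   from the term when an instance is inferred. *)
Definition as_sigma_finite (_ : sigma_finite setT mu) : set T -> \bar R := mu.

HB.instance Definition _ := Measure.on (as_sigma_finite mu_sigma_finite).
HB.instance Definition _ := @Measure_isSigmaFinite.Build _ _ _
  (as_sigma_finite mu_sigma_finite) mu_sigma_finite.

End sigma_finite_bundle.

Section complex_Fubini.
Context d1 d2 {T1 : measurableType d1} {T2 : measurableType d2} {R : realType}.
Variable m1 : {sigma_finite_measure set T1 -> \bar R}.
Variable m2 : {sigma_finite_measure set T2 -> \bar R}.
Variable f : T1 * T2 -> R[i].
Hypothesis mf : cmeasurable f.
Hypothesis fi1 : forall x, in_L1 m2 (fun y => f (x, y)).
Hypothesis fi2 : forall y, in_L1 m1 (fun x => f (x, y)).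
Hypothesis fi : (\int[m1]_x \int[m2]_y (normc (f (x, y)))%:E < +oo)%E.

Let real_Fubini (h : T1 * T2 -> R) : measurable_fun setT h ->
  (forall z, `|h z| <= normc (f z)) ->
  (forall x, m2.-integrable setT (fun y => (h (x, y))%:E)) ->
  (forall y, m1.-integrable setT (fun x => (h (x, y))%:E)) ->
  [/\ Rintegral m1 setT (fun x => Rintegral m2 setT (fun y => h (x, y))) =
      Rintegral m2 setT (fun y => Rintegral m1 setT (fun x => h (x, y))),
   measurable_fun setT (fun x => Rintegral m2 setT (fun y => h (x, y))) &
   measurable_fun setT (fun y => Rintegral m1 setT (fun x => h (x, y)))].
Proof.
move=> mh hf h2 h1.
have mhE : measurable_fun setT (fun z => (h z)%:E) by exact/measurable_EFinP.
have mnE : measurable_fun setT (fun z => (normc (f z))%:E).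
  exact/measurable_EFinP/measurable_normc.
have hi : (m1 \x m2)%E.-integrable setT (fun z => (h z)%:E).
  apply: (proj2 (integrable12ltyP m1 m2 mhE)); apply: le_lt_trans fi.
  have le0 x : (0 <= \int[m2]_y `|(h (x, y))%:E|)%E by exact: integral_ge0.
  apply: ge0_le_integral => //.
  - apply: (measurable_fun_fubini_tonelli_F (m2 := m2) (fun z =>
      `|(h z)%:E|%E)) => //.
    exact: measurableT_comp.
  - by apply: (measurable_fun_fubini_tonelli_F (m2 := m2) (fun z =>
      (normc (f z))%:E)) => // z; rewrite lee_fin normc_ge0.
  - move=> x _; apply: ge0_le_integral => //.
    + by apply: measurableT_comp => //; exact: measurable_int (h2 x).
    + by apply/measurable_EFinP/measurable_normc; exact: (fi1 x).1.
    + by move=> y _; rewrite lee_fin.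
have E2 x : (Rintegral m2 setT (fun y => h (x, y)))%:E = (\int[m2]_y (h (x,
  y))%:E)%E.
  by rewrite /Rintegral fineK//; exact: integrable_fin_num.
have E1 y : (Rintegral m1 setT (fun x => h (x, y)))%:E = (\int[m1]_x (h (x,
  y))%:E)%E.
  by rewrite /Rintegral fineK//; exact: integrable_fin_num.
split.
- rewrite /Rintegral; congr fine.
  under eq_integral do rewrite E2; under [RHS]eq_integral do rewrite E1.
  exact: (Fubini hi).
- apply/measurable_EFinP;
    rewrite (_ : _ \o _ = fubini_F m2 (fun z => (h z)%:E)).
    exact: measurable_fubini_F hi.
  by apply/funext => x /=; rewrite E2.
- apply/measurable_EFinP;
    rewrite (_ : _ \o _ = fubini_G m1 (fun z => (h z)%:E)).
    exact: measurable_fubini_G hi.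
  by apply/funext => x /=; rewrite E1.
Qed.

Lemma cFubini_sigma_finite : [/\ cintegral m1 (fun x => cintegral m2 (fun y =>
  f (x, y))) =
    cintegral m2 (fun y => cintegral m1 (fun x => f (x, y))),
    cmeasurable (fun x => cintegral m2 (fun y => f (x, y))) &
    cmeasurable (fun y => cintegral m1 (fun x => f (x, y)))].
Proof.
have [||||r1 r2 r3] := @real_Fubini (fun z => complex.Re (f z)).
- exact: mf.1.
- by move=> z; exact: ler_Re_normc.
- by move=> x; have [] := (in_L1P _ _).1 (fi1 x).
- by move=> y; have [] := (in_L1P _ _).1 (fi2 y).
have [||||i1 i2 i3] := @real_Fubini (fun z => complex.Im (f z)).
- exact: mf.2.
- by move=> z; exact: ler_Im_normc.
- by move=> x; have [] := (in_L1P _ _).1 (fi1 x).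
- by move=> y; have [] := (in_L1P _ _).1 (fi2 y).
by split; [congr (_ +i* _)|split|split].
Qed.

End complex_Fubini.

(** Integrability of every section, not only of almost every one, ensures that
   the inner integrals, which are real numbers by definition, agree with the
   extended real integrals of the classical theorem. *)
Lemma cFubini d1 d2 (T1 : measurableType d1) (T2 : measurableType d2)
    (R : realType) (m1 : {measure set T1 -> \bar R})
    (m2 : {measure set T2 -> \bar R}) (f : T1 * T2 -> R[i]) :
  sigma_finite setT m1 -> sigma_finite setT m2 -> cmeasurable f ->
  (forall x, in_L1 m2 (fun y => f (x, y))) ->
  (forall y, in_L1 m1 (fun x => f (x, y))) ->
  (\int[m1]_x \int[m2]_y (normc (f (x, y)))%:E < +oo)%E ->
  [/\ cintegral m1 (fun x => cintegral m2 (fun y => f (x, y))) =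
      cintegral m2 (fun y => cintegral m1 (fun x => f (x, y))),
      cmeasurable (fun x => cintegral m2 (fun y => f (x, y))) &
      cmeasurable (fun y => cintegral m1 (fun x => f (x, y)))].
Proof.
(* only a measure in constructor form is convertible to its bundled copy *)
case: m1 => m1' [c1 c1']; case: m2 => m2' [c2 c2'] sf1 sf2 mf fi1 fi2 fi.
exact: (@cFubini_sigma_finite _ _ T1 T2 R (as_sigma_finite sf1)
  (as_sigma_finite sf2) f mf fi1 fi2 fi).
Qed.

Lemma indic_trivIset_bigcup (R : realType) (T : Type) (A : nat -> set T) n x :
  trivIset `I_n A ->
  \1_(\bigcup_(j in `I_n) A j) x = \sum_(j < n) \1_(A j) x :> R.
Proof.
move=> tA; rewrite indicE; have [|] := boolP (x \in _).
  rewrite inE => -[j jn Ajx]; rewrite (bigD1 (Ordinal jn))//= indicE mem_set//.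
  rewrite big1 ?addr0// => k kj; rewrite indicE memNset// => Akx.
  move/eqP : kj; apply; apply/val_inj; apply: (tA _ _ (ltn_ord k) jn).
  by exists x.
rewrite notin_setE => nA; rewrite big1// => j _;
  rewrite indicE memNset// => Ajx.
by apply: nA; exists j => //=.
Qed.

Section complex_integral_extra.
Context d {T : measurableType d} {R : realType}.
Variable mu : {measure set T -> \bar R}.
Implicit Types f g : T -> R[i].

Lemma cintegral_indic (A : set T) : measurable A ->
  cintegral mu (fun x => (\1_A x : R)%:C) = (fine (mu A))%:C.
Proof.
move=> mA; rewrite /cintegral /Rintegral /= integral0.
by rewrite integral_indic// setIT.
Qed.

Lemma cintegral_sum n (h : nat -> T -> R[i]) : (forall j, in_L1 mu (h j)) ->
  cintegral mu (fun x => \sum_(j < n) h j x) = \sum_(j < n) cintegral mu (h j).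
Proof.
move=> hi; have i0 : in_L1 mu (fun=> 0).
  by have := in_L1Zl 0 (hi 0%N); under eq_fun do rewrite mul0r.
suff : in_L1 mu (fun x => \sum_(j < n) h j x) /\
  cintegral mu (fun x => \sum_(j < n) h j x) = \sum_(j < n) cintegral mu (h j)
    by case.
elim: n => [|n [IHi IHn]].
  rewrite big_ord0 (_ : (fun _ => _) = (fun=> 0)); last first.
    by apply/funext => x; rewrite big_ord0.
  split => //; rewrite (eq_cintegral mu (g := fun x => 0 * h 0%N x)).
    by rewrite cintegralZl// mul0r.
  by move=> x; rewrite mul0r.
rewrite big_ord_recr /= (_ : (fun _ => _) = (fun x =>
  \sum_(j < n) h j x + h n x)); last first.
  by apply/funext => x; rewrite big_ord_recr.
by split; [exact: in_L1D|rewrite cintegralD// IHn].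
Qed.

Lemma in_L1_indic (A : set T) : measurable A -> (mu A < +oo)%E ->
  in_L1 mu (fun x => (\1_A x : R)%:C).
Proof.
move=> mA muA; split; first exact: cmeasurable_indic.
rewrite cLnorm1E; under eq_integral do rewrite normc_real ger0_norm//.
by rewrite integral_indic// setIT.
Qed.

Lemma in_L1Zr f (c : R[i]) : in_L1 mu f -> in_L1 mu (fun x => f x * c).
Proof. by move=> /(in_L1Zl c); under eq_fun do rewrite mulrC. Qed.

Lemma cintegralZr f (c : R[i]) : in_L1 mu f ->
  cintegral mu (fun x => f x * c) = cintegral mu f * c.
Proof.
by move=> fi; rewrite mulrC -cintegralZl//; apply: eq_cintegral => x;
  rewrite mulrC.
Qed.

(** Multiplication by a bounded measurable function preserves integrability. *)
Lemma in_L1_bounded f g (c : R) : cmeasurable f ->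
  (forall x, normc (f x) <= c) ->
  in_L1 mu g -> in_L1 mu (fun x => f x * g x).
Proof.
move=> mf fc gi; apply: (in_L1_le _ (in_L1Zl (c%:C) gi)).
  by apply: cmeasurableM => //; exact: gi.1.
move=> x; rewrite !normcM ler_wpM2r ?normc_ge0// normc_real.
by apply: le_trans (fc x) _; exact: ler_norm.
Qed.

Lemma in_L1_unimodular f g : cmeasurable f -> (forall x, normc (f x) = 1) ->
  in_L1 mu g -> in_L1 mu (fun x => f x * g x).
Proof. by move=> mf f1; apply: (in_L1_bounded (c := 1) mf) => x;
  rewrite f1. Qed.

(** An eigenfunction of a measure-preserving map for an eigenvalue other than 1
   has integral zero, as the map leaves the integral unchanged. *)
Lemma cintegral_eigenfunction (tau : T -> T) f (c : R[i]) :
  measurable_fun setT tau ->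
  (forall A, measurable A -> mu (tau @^-1` A) = mu A) ->
  in_L1 mu f -> (forall x, f (tau x) = c * f x) -> c != 1 ->
  cintegral mu f = 0.
Proof.
move=> mtau tau_inv fi ftau c1.
have := cintegral_preserving mtau tau_inv fi.1.
rewrite (eq_cintegral _ ftau) cintegralZl// => /eqP.
rewrite -subr_eq0 -[X in _ - X]mul1r -mulrBl mulf_eq0 subr_eq0 (negbTE c1).
by move=> /eqP.
Qed.

End complex_integral_extra.

(** * Borel sets, Haar measure and the balls of a field of Laurent series *)

Lemma borel_open (T : ptopologicalType) (U : set (borel T)) :
  open (U : set T) -> measurable U.
Proof. by move=> oU; exact: sub_sigma_algebra. Qed.

Lemma borel_closed (T : ptopologicalType) (U : set (borel T)) :
  closed (U : set T) -> measurable U.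
Proof.
move=> cU; rewrite -[U]setCK; apply: measurableC; apply: borel_open.
exact: closed_openC.
Qed.

Lemma continuous_borel (T : ptopologicalType) (f : T -> T) :
  continuous f -> measurable_fun setT (f : borel T -> borel T).
Proof.
move=> cf; apply: (measurability (@open T : set (set (borel T)))) =>
  // _ [U oU <-].
by rewrite setTI; apply: borel_open; move/continuousP : cf; apply.
Qed.

Lemma continuous_borel_real (R : realType) (T : ptopologicalType) (f : T -> R) :
  continuous f -> measurable_fun setT (f : borel T -> R).
Proof.
move=> cf; apply: (measurability _ (RGenOInfty.measurableE R)).
move=> _ [_ [a ->] <-]; rewrite setTI; apply: borel_open.
by move/continuousP : cf; apply; exact: interval_open.
Qed.

Lemma continuous_cmeasurable (R : realType) (T : ptopologicalType)
  (f : T -> R[i]^o) : continuous f -> cmeasurable (f : borel T -> R[i]).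
Proof.
have key (g : R[i] -> R) : (forall z w, `|g z - g w| <= normc (z - w)) ->
    continuous (g : R[i]^o -> R).
  move=> gl z U /nbhs_ballP[e /= e0 eU].
  apply/(@nbhs_ballP _ R[i]^o); exists e%:C; first by rewrite /= ltcR.
  move=> w; rewrite -ball_normE /= normc_normr ltcR => zw; apply: eU.
  by rewrite -ball_normE /=; apply: le_lt_trans (gl z w) zw.
move=> cf; split; apply: continuous_borel_real => x.
  apply: (@continuous_comp _ R[i]^o _ f); first exact: cf.
  by apply: key => z w; rewrite -cReN -cReD ler_Re_normc.
apply: (@continuous_comp _ R[i]^o _ f); first exact: cf.
by apply: key => z w; rewrite -cImN -cImD ler_Im_normc.
Qed.

Lemma countable_bigcup_measurable d (T : measurableType d) (I : Type)
    (D : set I) (A : I -> set T) : countable D ->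
  (forall i, D i -> measurable (A i)) -> measurable (\bigcup_(i in D) A i).
Proof.
move=> /countable_injP[e einj] mA.
rewrite (_ : \bigcup_(i in D) A i =
    \bigcup_n \bigcup_(i in D `&` e @^-1` [set n]) A i); last first.
  apply/seteqP; split=> [x [i Di Aix]|x [n _ [i [Di _] Aix]]]; last by exists i.
  by exists (e i) => //; exists i.
apply: bigcupT_measurable => n.
have [[i [Di ein]]|/nonemptyPn ->] :=
  pselect (D `&` e @^-1` [set n] !=set0); last by rewrite bigcup_set0.
rewrite (_ : D `&` _ = [set i]) ?bigcup_set1; first exact: mA.
apply/seteqP; split=> [j [Dj ejn]|_ ->] //=.
by apply: einj; rewrite ?inE//= ejn ein.
Qed.

Lemma measure_bigcup_fin_lty d (T : measurableType d) (R : realType)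
    (mu : {measure set T -> \bar R}) (I : choiceType) (D : set I) (A : I ->
      set T) :
  finite_set D -> (forall i, measurable (A i)) ->
  (forall i, (mu (A i) < +oo)%E) -> (mu (\bigcup_(i in D) A i) < +oo)%E.
Proof.
move=> /finite_seqP[r ->] mA finA; rewrite bigcup_seq.
elim: r => [|i r IHr]; first by rewrite big_nil measure0.
rewrite big_cons; apply: le_lt_trans (measureU2 _ _ _) _; [exact: mA| |].
  by apply: bigsetU_measurable => j _; exact: mA.
by apply: lte_add_pinfty; [exact: finA|exact: IHr].
Qed.

Section haar_translation.
Context {R : realType} {G : ptopologicalType}.
Variables (mul : G -> G -> G) (mu : {measure set (borel G) -> \bar R}).
Hypothesis mu_haar : is_haar mul mu.

(** The invariance of a Haar measure is stated with images of sets, whereas a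
   change of variables needs preimages; translations being invertible, the two
   are the same. *)
Lemma haar_preimage (x y : G) : cancel (mul x) (mul y) ->
  cancel (mul y) (mul x) ->
  forall A : set (borel G), measurable A -> mu (mul x @^-1` A) = mu A.
Proof.
move=> xy yx A mA; have [_ inv _ _ _] := mu_haar; rewrite -(inv y A mA).
congr (mu _); apply/seteqP; split=> [z Az|_ [z Az <-]]; last by rewrite /= yx.
by exists (mul x z).
Qed.

End haar_translation.

Section laurent_balls.
Variable F : fieldType.
Local Notation K := (laurent F).
Implicit Types (x y : K) (n m : int).

(** The cosets [y + K_n] are the balls of the ultrametric topology of [K]. *)
Definition lcball n y : set K := [set x | lball n (x - y)].

Lemma lcball0 n : lcball n 0 = lball n.
Proof. by apply/funext => x; rewrite /lcball/= subr0. Qed.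

Lemma lballN n x : lball n x -> lball n (- x).
Proof. by move=> nx; rewrite -sub0r; apply: lballB. Qed.

Lemma lcball_sym n x y : lcball n y x -> lcball n x y.
Proof. by rewrite /lcball/= => /lballN; rewrite opprB. Qed.

Lemma lcball_trans n x y z : lcball n y x -> lcball n z y -> lcball n z x.
Proof. by rewrite /lcball/= => xy /(lballD xy); rewrite addrA subrK. Qed.

Lemma lcball_sub m n y : m <= n -> lcball n y `<=` lcball m y.
Proof. by move=> mn x; exact: lball_sub. Qed.

Lemma lcball_eq n x y : lcball n y x -> lcball n x = lcball n y.
Proof.
move=> xy; apply/seteqP; split => z zx; first exact: lcball_trans zx xy.
exact: lcball_trans zx (lcball_sym xy).
Qed.

Lemma lcball_open n y : open (lcball n y).
Proof.
rewrite openE => x xy; exists n => z zx; exact: lcball_trans zx xy.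
Qed.

Lemma measurable_lcball n y : measurable (lcball n y : set (borel K)).
Proof. by apply: borel_open; exact: lcball_open. Qed.

Lemma measurable_lball n : measurable (lball n : set (borel K)).
Proof. by rewrite -lcball0; exact: measurable_lcball. Qed.

(** Two balls are disjoint or nested, so adding the empty set makes them a family
   stable under intersection. *)
Definition balls : set (set K) :=
  [set B | B = set0 \/ exists n y, B = lcball n y].

Lemma balls_setI : setI_closed balls.
Proof.
move=> A B; case=> [->|[n [y ->]]]; first by rewrite set0I; left.
case=> [->|[m [z ->]]]; first by rewrite setI0; left.
wlog mn : m n y z / m <= n => [hw|].
  by case: (leP m n) => [|/ltW] mn; [exact: hw|rewrite setIC; exact: hw].
have [[x [/= xy xz]]|/nonemptyPn ->] :=
  pselect (lcball n y `&` lcball m z !=set0); last by left.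
right; exists n, x; rewrite -(lcball_eq xy) -(lcball_eq xz).
by apply/setIidl/lcball_sub.
Qed.

Lemma lball_exhaust x : exists n : nat, lball (- n%:Z) x.
Proof. by have [n xn] := lcoef_lb x; exists n. Qed.

Lemma lcoef_mono n (c : F) j : lcoef (lmono n c) j = c *+ (j == n).
Proof. by []. Qed.

Hypothesis F_finite : finite_set [set: F].

(** By induction on [k]: the coordinate at [m + k] takes finitely many values. *)
Lemma finite_representatives m (k : nat) : exists S : set K,
  finite_set S /\ forall x, lball m x ->
    exists2 y, S y & lball (m + k%:Z) (x - y).
Proof.
elim: k => [|k [S [fS HS]]].
  exists [set 0]; split; first exact: finite_set1.
  by move=> x xm; exists 0 => //; rewrite addr0 subr0.
exists [set a + b | a in S & b in [set lmono (m + k%:Z) c | c in [set: F]]].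
split; first by apply: finite_image2 => //; exact: finite_image.
move=> x /HS[y Sy xy]; exists (y + lmono (m + k%:Z) (lcoef (x - y) (m + k%:Z))).
  by exists y => //; eexists; [|reflexivity]; exists (lcoef (x - y) (m + k%:Z)).
move=> j jk; rewrite opprD addrA lcoefB lcoef_mono.
have [->|jne] := eqVneq j (m + k%:Z); first by rewrite mulr1n subrr.
by rewrite mulr0n subr0 xy//; lia.
Qed.

Lemma countable_representatives : exists D : set K,
  countable D /\ forall n x, exists2 y, D y & lcball n y x.
Proof.
have /choice[S HS] (mk : nat * nat) := finite_representatives (- mk.1%:Z) mk.2.
exists (\bigcup_(mk in [set: nat * nat]) S mk); split.
  by apply: bigcup_countable => // mk _; exact/finite_set_countable/(HS mk).1.
move=> n x; have [m xm] := lball_exhaust x.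
have [y Sy xy] := (HS (m, absz (n + m%:Z))).2 x xm.
by exists y; [exists (m, absz (n + m%:Z))|apply: lball_sub xy => /=; lia].
Qed.

(** Every open set is a union of balls centred in the countable set of
   representatives, hence a countable union of balls. *)
Lemma borel_balls : @measurable _ (borel K) = <<s balls >>.
Proof.
apply/seteqP; split.
  apply: smallest_sub; first exact: smallest_sigma_algebra.
  move=> U oU; have [D [cD DP]] := countable_representatives.
  pose I := [set ny : int * K | D ny.2 /\ lcball ny.1 ny.2 `<=` U].
  have -> : U = \bigcup_(ny in I) lcball ny.1 ny.2.
    apply/seteqP; split => [x Ux|x [ny [_]]]; last by apply.
    move: oU; rewrite openE => /(_ x Ux)[n xU]; have [y Dy xy] := DP n x.
    exists (n, y) => //; split => //=.
    by rewrite -(lcball_eq xy).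
  have cI : countable I.
    apply: (@sub_countable _ _ _ (setT `*` D)); last exact: countableX.
    by apply: subset_card_le => ny [Dny _].
  pose T := g_sigma_algebraType balls.
  have : @measurable _ T (\bigcup_(ny in I) lcball ny.1 ny.2).
    apply: (countable_bigcup_measurable (T := T)) => // ny _;
      apply: sub_sigma_algebra.
    by right; exists ny.1, ny.2.
  by [].
apply: smallest_sub; first exact: smallest_sigma_algebra.
move=> B [->|[n [y ->]]]; first exact: measurable0.
exact: measurable_lcball.
Qed.

End laurent_balls.

Section determined_by_balls.
Context {R : realType} {F : fieldType}.
Hypothesis F_finite : finite_set [set: F].
Local Notation K := (laurent F).
Variable mu : {measure set (borel K) -> \bar R}.

(** Within a fixed [K_n], the sets over which [r] has integral zero form a Dynkin
   system. It contains the balls, which are stable under intersection and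
   generate the Borel sets, so it contains all Borel sets. *)
Lemma ae_eq0_balls (r : K -> R) :
  (forall n, mu.-integrable (lball n : set (borel K)) (fun x => (r x)%:E)) ->
  (forall n y, \int[mu]_(x in (lcball n y : set (borel K))) (r x)%:E = 0)%E ->
  {ae mu, forall x : borel K, r x = 0}.
Proof.
move=> ri r0; suff H (n : nat) : {ae mu, forall x : borel K,
  lball (- n%:Z) x -> r x = 0}.
  have := ae_foralln H; apply: filterS => x xH.
  by have [n xn] := lball_exhaust x; exact: xH xn.
pose D : set (borel K) := lball (- n%:Z).
have mD : measurable D by exact: measurable_lball.
have rD := ri (- n%:Z).
have rDS S : measurable S -> mu.-integrable (S `&` D) (fun x => (r x)%:E).
  move=> mS; apply: integrableS rD => //; first exact: measurableI.
pose P (S : set (borel K)) := (\int[mu]_(x in S `&` D) (r x)%:E = 0)%E.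
have H S : measurable S -> P S.
  rewrite borel_balls//; move: S;
    apply: (@dynkin_induction _ (borel K) (@balls F) P).
  - exact: borel_balls.
  - exact: balls_setI.
  - by rewrite /P setTI /D -lcball0 r0.
  - rewrite /P => B bB; have : balls (B `&` D).
      by apply: balls_setI => //; right; exists (- n%:Z), 0; rewrite lcball0.
    by case=> [->|[m [y ->]]]; [rewrite integral_set0|rewrite r0].
  - rewrite /P => S mS S0; have := r0 (- n%:Z) 0;
      rewrite lcball0 -/D -{1}(setIT D) -(setUv S) setIUr.
    rewrite integral_setU_EFin; first last.
    + by rewrite disj_set2E; apply/eqP; rewrite setIACA setICr setI0.
    + by rewrite -setIUr setUv setIT; apply/measurable_EFinP;
        exact: measurable_int rD.
    + by apply: measurableI => //; exact: measurableC.
    + exact: measurableI.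
    by rewrite [D `&` S]setIC S0 add0e setIC.
  - rewrite /P => A mA tA A0; rewrite setI_bigcupl integral_bigcup.
    + by apply: eseries0 => i _ _; exact: A0.
    + exact: trivIset_setIr.
    + by move=> k; exact: measurableI.
    + by rewrite -setI_bigcupl; apply: rDS; exact: bigcupT_measurable.
have : ae_eq mu D (fun x => (r x)%:E) (cst 0%E).
  apply: integral_ae_eq => // E ED mE.
  by rewrite integral0 -(H E mE); congr integral; apply/esym/setIidl.
by apply: filterS => x h Dx; have [] := h Dx.
Qed.

(** Meant for [q] the real part or the imaginary part. *)
Lemma integral_ball_part (h : K -> R[i]) (q : R[i] -> R) n y :
  (forall (a : R) z, q (a%:C * z) = a * q z) ->
  (\int[mu]_(x in (lcball n y : set (borel K))) (q (h x))%:E =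
   \int[mu]_x (q ((\1_(lcball n y) x)%:C * h x))%:E)%E.
Proof.
move=> qM; rewrite integral_mkcond; apply: eq_integral => x _.
rewrite qM /patch indicE; case: ifP => _; by rewrite ?mul1r ?mul0r.
Qed.

(** An integrable function is determined almost everywhere by its integrals
   over balls, since these generate the Borel sets. *)
Lemma ae_eq_balls (f g : borel K -> R[i]) :
  (forall n y, in_L1 mu (fun x : borel K => (\1_(lcball n y) x : R)%:C * f x))
    ->
  (forall n y, in_L1 mu (fun x : borel K => (\1_(lcball n y) x : R)%:C * g x))
    ->
  (forall n y, cintegral mu (fun x : borel K => (\1_(lcball n y) x)%:C * f x) =
    cintegral mu (fun x : borel K => (\1_(lcball n y) x)%:C * g x)) ->
  {ae mu, forall x, f x = g x}.
Proof.
move=> fi gi fg; pose h x := f x - g x.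
have hi n y : in_L1 mu (fun x : borel K => (\1_(lcball n y) x : R)%:C * h x).
  rewrite /h; under eq_fun do rewrite mulrBr.
  by apply: in_L1D => //; exact: in_L1N.
have h0 n y : cintegral mu (fun x : borel K => (\1_(lcball n y) x)%:C * h x)
  = 0.
  rewrite (eq_cintegral _ (g := fun x : borel K =>
    (\1_(lcball n y) x)%:C * f x -
    (\1_(lcball n y) x)%:C * g x)); last by move=> x; rewrite /h mulrBr.
  by rewrite cintegralB// fg subrr.
have key (q : R[i] -> R) : (forall (a : R) z, q (a%:C * z) = a * q z) ->
    (forall n y, mu.-integrable setT (fun x : borel K =>
      (q ((\1_(lcball n y) x)%:C * h x))%:E)) ->
    (forall n y, Rintegral mu setT (fun x : borel K =>
      q ((\1_(lcball n y) x)%:C * h x)) = 0) ->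
    {ae mu, forall x, q (h x) = 0}.
  move=> qM qi q0; apply: ae_eq0_balls => [n|n y].
    apply/integrable_mkcond; first exact: measurable_lball.
    have := qi n 0; rewrite lcball0; apply: eq_integrable => // x _.
    by rewrite qM /patch indicE; case: ifP => _; rewrite ?mul1r ?mul0r.
  rewrite integral_ball_part//; have := q0 n y; rewrite /Rintegral.
  have : (\int[mu]_x (q ((\1_(lcball n y) x)%:C * h x))%:E)%E \is a fin_num.
    exact: integrable_fin_num (qi n y).
  by move=> /fineK {2}<- ->.
have hRe : {ae mu, forall x, complex.Re (h x) = 0}.
  apply: key => [a z|n y|n y]; first by rewrite cReM mul0r subr0.
    exact: ((in_L1P _ _).1 (hi n y)).1.
  by have := congr1 (@complex.Re R) (h0 n y).
have hIm : {ae mu, forall x, complex.Im (h x) = 0}.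
  apply: key => [a z|n y|n y]; first by rewrite cImM mul0r addr0.
    exact: ((in_L1P _ _).1 (hi n y)).2.
  by have := congr1 (@complex.Im R) (h0 n y).
apply: filterS2 hRe hIm => x hr hm; apply/eqP; rewrite -subr_eq0 -/(h x).
by rewrite eq_complex hr hm !eqxx.
Qed.

End determined_by_balls.

(** * Characters *)

Section characters.
Context {R : realType} {G : topologicalZmodType}.
Local Notation X := (character R G).
Implicit Types (chi psi zeta : X) (x y : G).

Lemma cvalM chi psi x : cval (chi * psi)%g x = cval chi x * cval psi x.
Proof. by []. Qed.

Lemma character_mulC chi psi : (chi * psi)%g = (psi * chi)%g.
Proof. by apply: characterP => x; rewrite !cvalM mulrC. Qed.

Lemma cvalV chi x : cval (chi^-1)%g x = (cval chi x)^-1.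
Proof. by []. Qed.

Lemma normc_cval chi x : normc (cval chi x) = 1.
Proof. by apply: normc_eq1; exact: norm_cval. Qed.

Lemma cval_continuous chi : continuous (cval chi : G -> R[i]^o).
Proof. by have [] := cvalP chi. Qed.

Lemma cval0 chi : cval chi 0 = 1.
Proof.
apply: (mulfI (cval_neq0 chi 0)); rewrite -cvalD mulr1 addr0; reflexivity.
Qed.

Lemma cvalN chi x : cval chi (- x) = (cval chi x)^*.
Proof.
apply: (mulfI (cval_neq0 chi x)); rewrite -cvalD subrr cval0 mulc_conj.
by rewrite normc_cval expr1n.
Qed.

Lemma cvalB chi x y : cval chi (x - y) = cval chi x * (cval chi y)^*.
Proof. by rewrite cvalD cvalN. Qed.

Lemma cvalMn chi x n : cval chi (x *+ n) = cval chi x ^+ n.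
Proof.
by elim: n => [|n IHn]; rewrite ?mulr0n ?cval0 ?expr0// mulrS cvalD IHn exprS.
Qed.

(** The compact-open topology is that of uniform convergence on compact sets. *)
Lemma cvg_character chi0 (A : set G) (e : R[i]) : compact A -> 0 < e ->
  \forall chi \near chi0, forall y, A y -> `|cval chi0 y - cval chi y| < e.
Proof.
move=> cA e0.
pose FX := (set_val : X -> G -> R[i]) @ nbhs chi0.
have FF : Filter FX by exact: fmap_filter.
have cFX : {compact-open, FX --> (cval chi0 : G -> R[i]^o)}.
  exact: (@initial_continuous X {compact-open, G -> R[i]^o} set_val chi0).
have {cFX} := (compact_open_fam_compactP (@cval_continuous chi0) FF).1 cFX.
move=> /(@fam_cvgP G R[i]^o compact FX (cval chi0) FF).1 /(_ A cA).
move=> /(_ [set h | forall y, A y -> `|cval chi0 y - h y| < e]); apply.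
apply/uniform_nbhs; exists [set xy : R[i]^o * R[i]^o | ball xy.1 e xy.2]; split.
  by rewrite -entourage_ballE; exists e.
by move=> h hA y Ay /=; have := hA y Ay; rewrite /= -ball_normE.
Qed.

(** Multiplication by a function of modulus 1 preserves uniform distances. *)
Lemma mulg_continuous zeta : continuous (fun chi : X => (zeta * chi)%g).
Proof.
move=> chi0.
pose FX := (fun chi : X => cval (zeta * chi)%g) @ nbhs chi0.
have FF : Filter FX by exact: fmap_filter.
have cFX : {compact-open, FX --> (cval (zeta * chi0)%g : G -> R[i]^o)}.
  apply: (compact_open_fam_compactP (@cval_continuous (zeta * chi0)%g) FF).2.
  apply: (@fam_cvgP G R[i]^o compact FX _ FF).2 => A cA P /uniform_nbhs[E []].
  rewrite -entourage_ballE => -[e /= e0 eE] EP.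
  have := @cvg_character chi0 A e cA e0; apply: filterS => chi chie.
  apply: EP => y Ay; apply: eE; rewrite /= -ball_normE /=.
  by rewrite !cvalM -mulrBr normrM norm_cval mul1r chie.
move=> U [_ /= [[W oW <-]]] /= Wz WU.
have FXW : FX W by apply: (cFX W); apply: open_nbhs_nbhs; split.
apply: (@filterS _ (nbhs chi0) _ _ _ _ FXW) => chi Wchi; exact: WU.
Qed.

Lemma eval_continuous x : continuous (fun chi : X => cval chi x : R[i]^o).
Proof.
move=> chi0 U /nbhs_ballP[e /= e0 eU].
have := @cvg_character chi0 [set x] e (@compact_set1 _ x) e0.
by apply: filterS => chi chie; apply: eU; rewrite -ball_normE /=; exact: chie.
Qed.

Lemma cmeasurable_eval x : cmeasurable (fun chi : borel X => cval chi x).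
Proof. exact: continuous_cmeasurable (@eval_continuous x). Qed.

Lemma measurable_eval_eq (A : set G) (c : G -> R[i]) :
  measurable ([set chi | forall x, A x -> cval chi x = c x] : set (borel X)).
Proof.
apply: borel_closed.
rewrite (_ : mkset _ = \bigcap_(x in A) ((fun chi : X => cval chi x :
  R[i]^o) @^-1` [set c x])).
  apply: closed_bigI => x _; apply: closed_comp; last first.
    by apply: accessible_closed_set1; exact/hausdorff_accessible/norm_hausdorff.
  by move=> chi _; exact: eval_continuous.
by apply/seteqP; split.
Qed.

Lemma measurable_annihilator (A : set G) :
  measurable (annihilator A : set (borel X)).
Proof. exact: measurable_eval_eq. Qed.

Lemma annihilatorM (A : set G) chi psi : annihilator A chi ->
  annihilator A psi -> annihilator A (chi * psi)%g.
Proof. by move=> cA pA x Ax; rewrite cvalM cA// pA// mulr1. Qed.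

Lemma annihilatorV (A : set G) chi : annihilator A chi ->
  annihilator A (chi^-1)%g.
Proof. by move=> cA x Ax; rewrite cvalV cA// invr1. Qed.

Lemma measurable_mulg zeta :
  measurable_fun setT ((fun chi => (zeta * chi)%g) : borel X -> borel X).
Proof. by apply: continuous_borel; exact: mulg_continuous. Qed.

End characters.

Section torsion_characters.
Context {R : realType} {G : topologicalZmodType}.
Variable p : nat.
Hypothesis p_gt0 : (0 < p)%N.
Hypothesis G_torsion : forall x : G, x *+ p = 0.
Local Notation X := (character R G).

Lemma cval_root (chi : X) x : cval chi x ^+ p = 1.
Proof. by rewrite -cvalMn G_torsion cval0. Qed.

Lemma finite_roots_of_unity : finite_set [set z : R[i] | z ^+ p = 1].
Proof.
have [r rE] := closed_field_poly_normal ('X^p - 1 : {poly R[i]}).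
apply: (@sub_finite_set _ _ [set` r]); last exact: finite_seq.
move=> z /= zp; rewrite -root_prod_XsubC.
suff : root ('X^p - 1) z by rewrite {1}rE rootZ// lead_coefXnsubC// oner_eq0.
by rewrite rootE !hornerE zp subrr.
Qed.

(** The values of [chi] are among finitely many roots of unity, so some
   neighbourhood of 1 contains none of them but 1 itself. *)
Lemma cval_ker_open (chi : X) : \forall x \near (0 : G), cval chi x = 1.
Proof.
pose S : set R[i] := [set z | z ^+ p = 1] `\ 1.
have cS : closed (S : set R[i]^o).
  apply: accessible_finite_set_closed.1.
    exact/hausdorff_accessible/norm_hausdorff.
  exact/finite_setD/finite_roots_of_unity.
have nS : nbhs (cval chi 0 : R[i]^o) (~` S).
  by apply: open_nbhs_nbhs; split; [exact: closed_openC|rewrite cval0 => -[_];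
    apply].
have : nbhs (0 : G) (cval chi @^-1` (~` S)) by exact:
  (@cval_continuous _ _ chi 0 _ nS).
apply: filterS => x /= {}nS; apply: contrapT => x1; apply: nS; split;
  first exact: cval_root.
by move/x1.
Qed.

Context (nu : {measure set (borel X) -> \bar R}).
Hypothesis nu_haar : is_haar (fun chi psi : X => (chi * psi)%g) nu.

Lemma haar_mulg zeta (A : set (borel X)) : measurable A ->
  nu ((fun chi => (zeta * chi)%g) @^-1` A) = nu A.
Proof.
apply: (haar_preimage nu_haar (x := zeta) (y := (zeta^-1)%g)).
  exact: mulKg.
exact: mulKVg.
Qed.

(** The value at [y], a root of unity, cuts the annihilator of [A] into finitely
   many pieces, each of which is empty or a translate of the annihilator of [A]
   and [y]. *)
Lemma annihilator_adjoin_finite (A : set G) y :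
  (nu (annihilator (A `|` [set y])) < +oo)%E -> (nu (annihilator A) < +oo)%E.
Proof.
move=> fin.
pose B w : set X := [set chi | annihilator A chi /\ cval chi y = w].
have mB w : measurable (B w : set (borel X)).
  rewrite (_ : B w = annihilator A `&` [set chi | forall x, [set y] x ->
    cval chi x = w]).
    by apply: measurableI;
      [exact: measurable_annihilator|exact: (measurable_eval_eq _ (fun=> w))].
  apply/seteqP; split=> chi /= [cA cw]; split => //; last exact: cw.
  by move=> x ->.
have fB w : (nu (B w) < +oo)%E.
  have [[z [zA zy]]|/nonemptyPn ->] := pselect (B w !=set0);
    last by rewrite measure0.
  apply: le_lt_trans fin; rewrite le_eqVlt -[in eqbRHS](haar_mulg (z^-1)%g);
    last exact: measurable_annihilator.
  rewrite (_ : _ @^-1` _ = B w) ?eqxx//; apply/seteqP;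
    split => [chi /= h|chi [cA cy] x].
    split=> [x Ax|].
      have := h x (or_introl Ax); rewrite cvalM cvalV zA// invr1 mul1r; exact.
    have := h y (or_intror erefl); rewrite cvalM cvalV zy => e.
    have w0 : w != 0 by rewrite -zy cval_neq0.
    by rewrite -[LHS](mulVKf w0) e mulr1.
  case=> [Ax|->]; rewrite cvalM cvalV; first by rewrite zA// cA// invr1 mulr1.
  by rewrite zy cy mulVf// -cy cval_neq0.
rewrite (_ : annihilator A = \bigcup_(w in [set z | z ^+ p = 1]) B w).
  exact: measure_bigcup_fin_lty finite_roots_of_unity mB fB.
apply/seteqP; split=> [chi cA|chi [w _ []]//]; exists (cval chi y) => //=.
exact: cval_root.
Qed.

End torsion_characters.

(** * Fourier analysis on a field of Laurent series *)

Section Laurent_duality.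
Context {R : realType} {F : fieldType} {p : nat}.
Hypothesis p_gt0 : (0 < p)%N.
Hypothesis F_finite : finite_set [set: F].
Hypothesis F_char : p%:R = 0 :> F.
Local Notation K := (laurent F).
Local Notation X := (character R K).
Local Notation perp n := (annihilator (lball n : set K) : set X).
Variables (mu : {measure set (borel K) -> \bar R}).
Variables (nu : {measure set (borel X) -> \bar R}).
Hypothesis mu_haar : is_haar (fun x y : K => x + y) mu.
Hypothesis nu_haar : is_haar (fun chi psi : X => (chi * psi)%g) nu.
Hypothesis mu_lball0 : mu (lball 0) = 1%E.
Hypothesis nu_perp0 : nu (perp 0) = 1%E.

(** This makes the pairing nondegenerate. For a finite field [F], the characters
   [r_k^u] of single coordinates witness it. *)
Hypothesis perp_separating : forall n (x : K), ~ lball n x ->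
  exists2 chi : X, perp n chi & cval chi x != 1.

Lemma laurent_torsion (x : K) : x *+ p = 0.
Proof.
apply: laurentP => j.
have E n : lcoef (x *+ n) j = lcoef x j *+ n.
  by elim: n => [|n IHn]; rewrite ?mulr0n// !mulrS lcoefD IHn.
by rewrite E -mulr_natr F_char mulr0.
Qed.

Lemma measurable_shift (h : K) :
  measurable_fun setT ((fun x => h + x) : borel K -> borel K).
Proof.
apply: continuous_borel => x U [n nU]; exists n => y yx; apply: nU => /=.
by rewrite opprD addrACA subrr add0r.
Qed.

Lemma mu_shift (h : K) (A : set (borel K)) : measurable A ->
  mu ((fun x => h + x) @^-1` A) = mu A.
Proof.
by apply: (haar_preimage mu_haar (x := h) (y := - h)) => x;
  rewrite ?addKr ?addNKr.
Qed.

Lemma mu_lcball n (y : K) : mu (lcball n y) = mu (lball n).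
Proof.
rewrite -(mu_shift y (measurable_lcball n y)); congr (mu _).
by apply/funext => x; rewrite /lcball /= addrC addKr.
Qed.

(** For [n < 0], finitely many translates of [K_0] cover [K_n]. *)
Lemma mu_lball_lty n : (mu (lball n) < +oo)%E.
Proof.
have sub0 m : 0 <= m -> (mu (lball m) < +oo)%E.
  move=> m0; apply: (@le_lt_trans _ _ 1%E); last exact: ltry.
  by rewrite -mu_lball0 le_measure ?inE//;
    [exact: measurable_lball|exact: measurable_lball|exact: lball_sub].
case: (leP 0 n) => [|n0]; first exact: sub0.
have [S [fS HS]] := finite_representatives F_finite n `|n|%N.
apply: (@le_lt_trans _ _ (mu (\bigcup_(y in S) lcball 0 y))).
  apply: le_measure; rewrite ?inE.
  - exact: measurable_lball.
  - apply: countable_bigcup_measurable; first exact: finite_set_countable.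
    by move=> y _; exact: measurable_lcball.
  - move=> x /HS[y Sy xy]; exists y => //.
    by rewrite /lcball /= (_ : 0 = n + `|n|%N%:Z)//; lia.
apply: measure_bigcup_fin_lty => // y; first exact: measurable_lcball.
by rewrite mu_lcball sub0.
Qed.

Lemma perp_sub m n : m <= n -> perp m `<=` perp n.
Proof. by move=> mn chi cm x xn; apply: cm; exact: lball_sub xn. Qed.

Lemma perp_exhaust (chi : X) : exists n : nat, perp n%:Z chi.
Proof.
have [n nchi] := cval_ker_open p_gt0 laurent_torsion chi.
exists `|n|%N => x xn; apply: nchi; rewrite /= subr0; apply: lball_sub xn; lia.
Qed.

Lemma perp_lcball n (chi : X) x y : perp n chi -> lcball n y x ->
  cval chi x = cval chi y.
Proof. by move=> nchi xy; rewrite -(subrK y x) cvalD (nchi _ xy) mul1r. Qed.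

(** When representatives of [K_0] modulo [K_|n|] are adjoined to [K_n] one by one,
   its annihilator shrinks until it lies in that of [K_0]; by
   [annihilator_adjoin_finite], finiteness goes back through each step. *)
Lemma nu_perp_lty n : (nu (perp n) < +oo)%E.
Proof.
have [S [fS HS]] := finite_representatives F_finite 0 `|n|%N.
have [r rE] := (finite_seqP _).1 fS.
suff : (nu (annihilator (lball n `|` [set` r])) < +oo)%E.
  elim: (r) => [|y r' IHr].
    by rewrite (_ : [set` [::]] = set0) ?setU0//; apply/seteqP; split.
  move=> fin; apply: IHr;
    apply: (annihilator_adjoin_finite p_gt0 laurent_torsion nu_haar (y := y)).
  apply: le_lt_trans fin; apply: le_measure; rewrite ?inE;
    try exact: measurable_annihilator.
  move=> chi cA x [xn|/=]; first by apply: cA; left; left.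
  by rewrite inE => /orP[/eqP ->|xr]; apply: cA; [right|left; right].
apply: (@le_lt_trans _ _ 1%E); last exact: ltry.
rewrite -nu_perp0 le_measure ?inE//; try exact: measurable_annihilator.
move=> chi cA x /HS[y Sy xy].
rewrite -(subrK y x) cvalD !cA ?mulr1//; last by left; apply: lball_sub xy; lia.
by right; rewrite -rE.
Qed.

Lemma sigma_finite_mu : sigma_finite setT mu.
Proof.
exists (fun n : nat => lball (- n%:Z)); last first.
  by move=> n; split; [exact: measurable_lball|exact: mu_lball_lty].
by apply/seteqP; split => // x _; have [n xn] := lball_exhaust x; exists n.
Qed.

Lemma sigma_finite_nu : sigma_finite setT nu.
Proof.
exists (fun n : nat => perp n%:Z); last first.
  by move=> n; split; [exact: measurable_annihilator|exact: nu_perp_lty].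
by apply/seteqP; split => // x _; have [n xn] := perp_exhaust x; exists n.
Qed.

Lemma cmeasurable_cval (chi : X) : cmeasurable (fun x : borel K => cval chi x).
Proof. exact: continuous_cmeasurable (@cval_continuous _ _ chi). Qed.

(** The pairing is jointly measurable: on the product of a ball of radius [n]
   and the annihilator of [K_n] it depends on the character alone, and countably
   many such products cover. *)
Lemma cmeasurable_pairing :
  cmeasurable (fun z : borel K * borel X => cval z.2 z.1).
Proof.
have [D [cD DP]] := countable_representatives F_finite.
suff key (h : R[i] -> R) : (forall y, measurable_fun setT (fun chi : borel X =>
  h (cval chi y))) ->
    measurable_fun setT (fun z : borel K * borel X => h (cval z.2 z.1)).
  by split; apply: key => y;
    [exact: (cmeasurable_eval y).1|exact: (cmeasurable_eval y).2].
move=> mh _ V mV; rewrite setTI.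
rewrite (_ : _ @^-1` V = \bigcup_(n : nat) \bigcup_(y in D) (lcball n%:Z y `*`
    (perp n%:Z `&` (setT `&` (fun chi => h (cval chi y)) @^-1` V)))).
  apply: bigcupT_measurable => n; apply: countable_bigcup_measurable => // y _.
  apply: measurableX; first exact: measurable_lcball.
  by apply: measurableI; [exact: measurable_annihilator|exact: mh].
apply/seteqP; split=> [[x chi] /= Vh|[x chi] [n _ [y Dy [/= xy [nchi [_]]]]]].
  have [n nchi] := perp_exhaust chi; have [y Dy xy] := DP n%:Z x.
  exists n => //; exists y => //; split => //=; split => //; split => //=.
  by rewrite -(perp_lcball nchi xy).
by rewrite /= (perp_lcball nchi xy).
Qed.

Lemma fourierE u (chi : X) :
  fourier mu u chi = cintegral mu (fun x => u x * (cval chi x)^*).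
Proof. by []. Qed.

Section multiplication_formula.
Variables (u : K -> R[i]) (g : X -> R[i]).
Hypotheses (ui : in_L1 mu u) (gi : in_L1 nu g).

Let f (z : borel K * borel X) : R[i] := u z.1 * (cval z.2 z.1)^* * g z.2.

Let mf : cmeasurable f.
Proof.
apply: cmeasurableM; first apply: cmeasurableM.
- by split; [exact: measurableT_comp ui.1.1 measurable_fst|exact:
    measurableT_comp ui.1.2 measurable_fst].
- exact: cmeasurableJ cmeasurable_pairing.
- by split; [exact: measurableT_comp gi.1.1 measurable_snd|exact:
    measurableT_comp gi.1.2 measurable_snd].
Qed.

Let normc_f x chi : normc (f (x, chi)) = normc (u x) * normc (g chi).
Proof. by rewrite /f /= !normcM normc_conj normc_cval mulr1. Qed.

Let uchi_i chi : in_L1 mu (fun x => u x * (cval chi x)^*).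
Proof.
under eq_fun do rewrite mulrC.
apply: in_L1_unimodular => //; first exact/cmeasurableJ/cmeasurable_cval.
by move=> x; rewrite normc_conj normc_cval.
Qed.

Let xg_i x : in_L1 nu (fun chi => (cval chi x)^* * g chi).
Proof.
apply: in_L1_unimodular => //; first exact/cmeasurableJ/cmeasurable_eval.
by move=> chi; rewrite normc_conj normc_cval.
Qed.

Let fi1 x : in_L1 nu (fun chi => f (x, chi)).
Proof. by rewrite /f /=; under eq_fun do rewrite -mulrA; exact: in_L1Zl. Qed.

Let fi2 chi : in_L1 mu (fun x => f (x, chi)).
Proof. by rewrite /f /=; exact: in_L1Zr. Qed.

Let fi : (\int[mu]_x \int[nu]_chi (normc (f (x, chi)))%:E < +oo)%E.
Proof.
have mg : measurable_fun setT (fun chi : borel X => (normc (g chi))%:E).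
  exact/measurable_EFinP/measurable_normc/gi.1.
have mun : measurable_fun setT (fun x : borel K => (normc (u x))%:E).
  exact/measurable_EFinP/measurable_normc/ui.1.
have g0 : (0 <= \int[nu]_chi (normc (g chi))%:E)%E.
  by apply: integral_ge0 => chi _; rewrite lee_fin normc_ge0.
have gfin : (\int[nu]_chi (normc (g chi))%:E < +oo)%E.
  by have := gi.2; rewrite cLnorm1E.
under eq_integral => x _.
  under eq_integral do rewrite normc_f EFinM.
  rewrite ge0_integralZl//;
    [|by move=> ? _; rewrite lee_fin normc_ge0|by rewrite lee_fin normc_ge0].
  over.
rewrite ge0_integralZr//; last by move=> ? _; rewrite lee_fin normc_ge0.
apply: lte_mul_pinfty => //; first by apply: integral_ge0 => ? _;
  rewrite lee_fin normc_ge0.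
  rewrite ge0_fin_numE -?cLnorm1E ?ui.2//.
  by rewrite cLnorm1E; apply: integral_ge0 => ? _; rewrite lee_fin normc_ge0.
Qed.

(** Fubini's theorem for [u(x) * conj (chi(x)) * g(chi)]. It moves the Fourier
   transform from one factor to the other. *)
Lemma multiplication_formula :
  [/\ cintegral nu (fun chi => fourier mu u chi * g chi) =
      cintegral mu (fun x => u x * cintegral nu (fun chi =>
        (cval chi x)^* * g chi)),
      cmeasurable (fun x : borel K => u x * cintegral nu (fun chi =>
        (cval chi x)^* * g chi)) &
      cmeasurable (fun chi : borel X => fourier mu u chi * g chi)].
Proof.
have [e m1 m2] := cFubini sigma_finite_mu sigma_finite_nu mf fi1 fi2 fi.
have E2 chi : cintegral mu (fun x => f (x, chi)) = fourier mu u chi * g chi.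
  by rewrite fourierE -cintegralZr.
have E1 x : cintegral nu (fun chi => f (x, chi)) =
    u x * cintegral nu (fun chi => (cval chi x)^* * g chi).
  by rewrite -cintegralZl//; apply: eq_cintegral => chi; rewrite mulrA.
split; last by move: m2; under eq_fun do rewrite E2.
  by rewrite -(eq_cintegral _ E1) -(eq_cintegral _ E2) e.
by move: m1; under eq_fun do rewrite E1.
Qed.

End multiplication_formula.

Lemma cmeasurable_exhaust d (T : measurableType d) (A : nat -> set T)
    (h : T -> R[i]) : (forall n, measurable (A n)) ->
      (forall x, exists n, A n x) ->
  (forall n, cmeasurable (fun x => (\1_(A n) x : R)%:C * h x)) -> cmeasurable h.
Proof.
move=> mA AT mh; suff key (q : R[i] -> R) :
    (forall n, measurable_fun setT (fun x => q ((\1_(A n) x : R)%:C * h x))) ->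
    measurable_fun setT (fun x => q (h x)).
  by split; apply: key => n; [exact: (mh n).1|exact: (mh n).2].
move=> mq _ V mV; rewrite setTI.
rewrite (_ : _ @^-1` V = \bigcup_n (A n `&`
    (setT `&` (fun x => q ((\1_(A n) x : R)%:C * h x)) @^-1` V))).
  by apply: bigcupT_measurable => n; apply: measurableI => //; exact: mq.
have E n x : A n x -> (\1_(A n) x : R)%:C * h x = h x.
  by move=> Ax; rewrite indicE mem_set// mul1r.
apply/seteqP; split=> [x /= Vx|x [n _ [Ax [_ /=]]]]; last by rewrite E.
by have [n Ax] := AT x; exists n => //; split => //; split => //=; rewrite E.
Qed.

(** On the annihilator of a given [K_n], of finite measure, Fubini's theorem gives
   the measurability. *)
Lemma cmeasurable_fourier u : in_L1 mu u ->
  cmeasurable (fun chi : borel X => fourier mu u chi).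
Proof.
move=> ui; apply: (cmeasurable_exhaust (A := fun n : nat =>
  perp n%:Z : set (borel X))).
- by move=> n; exact: measurable_annihilator.
- exact: perp_exhaust.
- move=> n; under eq_fun do rewrite mulrC.
  have gi : in_L1 nu (fun chi : borel X => (\1_(perp n%:Z) chi : R)%:C).
    by apply: in_L1_indic; [exact: measurable_annihilator|exact: nu_perp_lty].
  by have [] := multiplication_formula ui gi.
Qed.

Lemma fourier_mul_in_L1 u g : in_L1 mu u -> in_L1 nu g ->
  in_L1 nu (fun chi => fourier mu u chi * g chi).
Proof.
move=> ui gi; apply: (in_L1_bounded (c := 2 * fine (cLnorm mu 1 u))) => //.
  exact: cmeasurable_fourier.
move=> chi; rewrite -lee_fin.
have uci : in_L1 mu (fun x => u x * (cval chi x)^*).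
  under eq_fun do rewrite mulrC.
  apply: in_L1_unimodular => //; first exact/cmeasurableJ/cmeasurable_cval.
  by move=> x; rewrite normc_conj normc_cval.
apply: le_trans (normc_cintegral uci) _; rewrite EFinM fineK; last first.
  by rewrite ge0_fin_numE ?ui.2//; exact: Lnorm_ge0.
rewrite (eq_cLnorm mu 1 (g := u))// => x.
by rewrite normcM normc_conj normc_cval mulr1.
Qed.

Lemma in_L1_ball n y : in_L1 mu (fun x : borel K => (\1_(lcball n y) x : R)%:C).
Proof.
by apply: in_L1_indic;
  [exact: measurable_lcball|rewrite mu_lcball mu_lball_lty].
Qed.

Lemma in_L1_perp n : in_L1 nu (fun chi : borel X => (\1_(perp n) chi : R)%:C).
Proof.
by apply: in_L1_indic; [exact: measurable_annihilator|exact: nu_perp_lty].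
Qed.

(** Orthogonality on the compact group [K_n]: a character that is not trivial on
   it is an eigenfunction of some translation. *)
Lemma fourier_lball n (chi : X) :
  fourier mu (fun x => (\1_(lball n) x)%:C) chi =
  (fine (mu (lball n)) * \1_(perp n) chi)%:C.
Proof.
rewrite fourierE [in RHS]indicE; have [|] := boolP (chi \in _).
  rewrite inE mulr1 => nchi; rewrite -cintegral_indic;
    last exact: measurable_lball.
  apply: eq_cintegral => x; rewrite indicE; have [|_] := boolP (x \in _);
    last by rewrite mul0r.
  by rewrite inE => /nchi ->; rewrite conjc_one mulr1.
rewrite mulr0 notin_setE => nchi.
have [x0 [nx0 x01]] : exists x0, lball n x0 /\ cval chi x0 <> 1.
  apply: contrapT => h; apply: nchi => x nx; apply: contrapT => x1.
  by apply: h; exists x.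
apply: (cintegral_eigenfunction (measurable_shift x0) (mu_shift x0) (c :=
  (cval chi x0)^*)).
- under eq_fun do rewrite mulrC.
  apply: in_L1_unimodular; first exact/cmeasurableJ/cmeasurable_cval.
    by move=> x; rewrite normc_conj normc_cval.
  by rewrite -lcball0; exact: in_L1_ball.
- move=> x; rewrite cvalD conjcM mulrCA; congr (_ * (_ * _)); congr (_%:C).
  rewrite !indicE; congr (_%:R); congr nat_of_bool; apply/idP/idP;
    rewrite !inE => h.
    by rewrite -(addKr x0 x) addrC; exact: lballB.
  exact: lballD.
- by apply/eqP => e; apply: x01; rewrite -[LHS]conjcK e conjc_one.
Qed.

(** Dually, orthogonality on the group of the characters trivial on [K_n]. *)
Lemma cintegral_perp n (x : K) :
  cintegral nu (fun chi => (\1_(perp n) chi)%:C * cval chi x) =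
  (fine (nu (perp n)) * \1_(lball n) x)%:C.
Proof.
rewrite [in RHS]indicE; have [|] := boolP (x \in _).
  rewrite inE mulr1 => nx; rewrite -cintegral_indic;
    last exact: measurable_annihilator.
  apply: eq_cintegral => chi; rewrite indicE; have [|_] := boolP (chi \in _);
    last by rewrite mul0r.
  by rewrite inE => /(_ x nx) ->; rewrite mulr1.
rewrite mulr0 notin_setE => nx; have [zeta nz z1] := perp_separating nx.
apply: (cintegral_eigenfunction (measurable_mulg zeta) (haar_mulg nu_haar zeta)
  (c := cval zeta x)) => //.
- under eq_fun do rewrite mulrC.
  apply: in_L1_unimodular; [exact: cmeasurable_eval|by move=> chi;
    rewrite normc_cval|exact: in_L1_perp].
- move=> chi; rewrite cvalM mulrCA; congr (_ * (_ * _)); congr (_%:C).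
  rewrite !indicE; congr (_%:R); congr nat_of_bool; apply/idP/idP;
    rewrite !inE => h.
    rewrite -(mulKg zeta chi); apply: annihilatorM => //; exact: annihilatorV.
  exact: annihilatorM.
Qed.

Lemma cintegral_perpJ n (x y : K) :
  cintegral nu (fun chi =>
    (cval chi x)^* * ((\1_(perp n) chi)%:C * cval chi y)) =
  (fine (nu (perp n)) * \1_(lcball n y) x)%:C.
Proof.
rewrite (eq_cintegral _ (g := fun chi : borel X =>
  (\1_(perp n) chi)%:C * cval chi (y - x))).
  rewrite cintegral_perp; congr (_ * _)%:C; rewrite !indicE; congr (_%:R).
  congr nat_of_bool; apply/idP/idP; rewrite !inE /lcball /= => /lballN;
    by rewrite opprB.
by move=> chi; rewrite cvalB mulrCA [(cval chi x)^* * _]mulrC.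
Qed.

Lemma in_L1_perp_cval n (y : K) :
  in_L1 nu (fun chi : borel X => (\1_(perp n) chi : R)%:C * cval chi y).
Proof.
under eq_fun do rewrite mulrC.
apply: in_L1_unimodular; [exact: cmeasurable_eval|by move=> chi;
  rewrite normc_cval|exact: in_L1_perp].
Qed.

Lemma fourier_lcball n y (chi : X) :
  fourier mu (fun x => (\1_(lcball n y) x)%:C) chi =
  (fine (mu (lball n)))%:C * ((\1_(perp n) chi)%:C * cval chi y)^*.
Proof.
rewrite conjcM conjcR mulrA -real_complexM -fourier_lball !fourierE.
rewrite -(cintegral_preserving (measurable_shift y) (mu_shift y)); last first.
  apply: cmeasurableM; last exact/cmeasurableJ/cmeasurable_cval.
  exact: (in_L1_ball n y).1.
rewrite -cintegralZr; last first.
  under eq_fun do rewrite mulrC.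
  apply: in_L1_unimodular; first exact/cmeasurableJ/cmeasurable_cval.
    by move=> x; rewrite normc_conj normc_cval.
  by rewrite -lcball0; exact: in_L1_ball.
apply: eq_cintegral => x; rewrite cvalD conjcM -mulrA [(cval chi x)^* * _]mulrC.
congr (_%:C * _); rewrite !indicE; congr (_%:R); congr nat_of_bool.
by apply/idP/idP; rewrite !inE /lcball /= addrC addKr.
Qed.

(** The two normalizations make the volumes of [K_n] and of its annihilator
   inverse to each other: the multiplication formula for the indicators of
   [K_m] and of the annihilator of [K_n] shows that their product does not
   depend on [n]. *)
Lemma mu_lball_nu_perp n : fine (mu (lball n)) * fine (nu (perp n)) = 1.
Proof.
have key m k : m <= k -> fine (mu (lball m)) * fine (nu (perp m)) =
    fine (mu (lball k)) * fine (nu (perp k)).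
  move=> mk.
  have [+ _ _] := multiplication_formula (in_L1_ball m 0) (in_L1_perp_cval k 0).
  rewrite (eq_cintegral nu (g := fun chi =>
    (fine (mu (lball m)))%:C * (\1_(perp m) chi)%:C)).
    rewrite cintegralZl; last exact: in_L1_perp.
    rewrite cintegral_indic; last exact: measurable_annihilator.
    rewrite (eq_cintegral mu (g := fun x : borel K =>
      (fine (nu (perp k)))%:C * (\1_(lcball k 0) x)%:C)).
      rewrite cintegralZl; last exact: in_L1_ball.
      rewrite cintegral_indic; last exact: measurable_lcball.
      rewrite -!real_complexM lcball0 => /complexI ->; exact: mulrC.
    move=> x; rewrite cintegral_perpJ real_complexM mulrCA -real_complexM;
      congr (_ * _%:C).
    rewrite !lcball0 !indicE -natrM mulnb; congr (_%:R); congr nat_of_bool.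
    by apply/andP/idP => [[]//|]; rewrite !inE => h; split => //;
      exact: lball_sub h.
  move=> chi; rewrite fourier_lcball cval0 !mulr1 conjcR -mulrA; congr (_ * _).
  rewrite -real_complexM; congr (_%:C); rewrite !indicE -natrM mulnb;
    congr (_%:R); congr nat_of_bool.
  by apply/andP/idP => [[]//|]; rewrite !inE => h; split => //;
    exact: perp_sub h.
have e0 : fine (mu (lball 0)) * fine (nu (perp 0)) = 1.
  by rewrite mu_lball0 nu_perp0 mulr1.
by case: (leP n 0) => [/key ->|/ltW /key <-].
Qed.

Lemma in_L2_indicM d (T : measurableType d) (m : {measure set T -> \bar R})
    (A : set T) (h : T -> R[i]) : measurable A -> (m A < +oo)%E ->
  cmeasurable h -> (forall x, normc (h x) = 1) ->
  in_L2 m (fun x => (\1_A x : R)%:C * h x).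
Proof.
move=> mA mAy mh h1; apply/in_L2P; split.
  by apply: cmeasurableM => //; exact: cmeasurable_indic.
have [_] := in_L1_indic mA mAy; rewrite cLnorm1E; apply: le_lt_trans.
rewrite le_eqVlt; apply/orP; left; apply/eqP; apply: eq_integral => x _.
rewrite normcM h1 mulr1 normc_real indicE; case: (x \in A).
  by rewrite normr1 expr1n.
by rewrite normr0 expr0n.
Qed.

Lemma in_L2_ball n y : in_L2 mu (fun x : borel K => (\1_(lcball n y) x : R)%:C).
Proof.
have : in_L2 mu (fun x : borel K => (\1_(lcball n y) x : R)%:C * 1).
  apply: in_L2_indicM;
    [exact: measurable_lcball|by rewrite mu_lcball mu_lball_lty|exact:
    cmeasurable_cst|].
  by move=> _; exact: normc1.
by congr in_L2; apply/funext => x; rewrite mulr1.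
Qed.

(** For an integrable function in place of [phi], this is the multiplication
   formula with [g] the transform of the indicator of a ball, up to conjugation
   and normalization. Both sides are continuous in the L2 norm. *)
Lemma fourier_L2_ball (phi : K -> R[i]) (psi : X -> R[i]) n y :
  fourier_L2 mu nu phi psi ->
  cintegral nu (fun chi => psi chi * ((\1_(perp n) chi)%:C * cval chi y)) =
  (fine (nu (perp n)))%:C * cintegral mu (fun x =>
    (\1_(lcball n y) x)%:C * phi x).
Proof.
move=> [phi2 [psi2 [u [u12 u_phi u_psi]]]].
pose g (chi : borel X) : R[i] := (\1_(perp n) chi)%:C * cval chi y.
pose v (x : borel K) : R[i] := (\1_(lcball n y) x)%:C.
have gi : in_L1 nu g by exact: in_L1_perp_cval.
have g2 : in_L2 nu g.
  apply: in_L2_indicM;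
    [exact: measurable_annihilator|exact: nu_perp_lty|exact: cmeasurable_eval|].
  by move=> chi; rewrite normc_cval.
have v2 : in_L2 mu v.
  exact: in_L2_ball.
have l1 : ccvg (fun k => cintegral nu (fun chi => fourier mu (u k) chi * g chi))
    (cintegral nu (fun chi => psi chi * g chi)).
  apply: L2_cvg_cintegral => // k; first exact/cmeasurable_fourier/(u12 k).1.
  by apply: fourier_mul_in_L1 => //; exact: (u12 k).1.
have l2 : ccvg (fun k => cintegral mu (fun x =>
  u k x * ((fine (nu (perp n)))%:C * v x)))
    (cintegral mu (fun x => phi x * ((fine (nu (perp n)))%:C * v x))).
  have cv2 : in_L2 mu (fun x => (fine (nu (perp n)))%:C * v x).
    by apply: in_L2Zl.
  apply: L2_cvg_cintegral => // k; first exact: (u12 k).1.1.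
  by apply: in_L2M => //; exact: (u12 k).2.
rewrite -/g -cintegralZl; last by apply: in_L2M.
rewrite [RHS](eq_cintegral mu (g := fun x =>
  phi x * ((fine (nu (perp n)))%:C * v x))); last first.
  by move=> x; rewrite [_ * phi x]mulrC mulrCA.
apply: ccvg_unique l1 _; move: l2; congr ccvg; apply/funext => k.
have [-> _ _] := multiplication_formula (u12 k).1 gi.
apply: eq_cintegral => x; congr (_ * _).
by rewrite cintegral_perpJ real_complexM.
Qed.

Section correlation.
Variables (phi : K -> R[i]) (psi : X -> R[i]).
Hypothesis phi_psi : fourier_L2 mu nu phi psi.
Hypothesis psi1 : in_L1 nu psi.

Let psiJ : in_L1 nu (fun chi => (psi chi)^*). Proof. exact: in_L1J. Qed.

(** The complex conjugate of the inverse Fourier transform of [psi]: in this form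
   it is an inner integral of the multiplication formula. *)
Let Phi (x : K) : R[i] := cintegral nu (fun chi =>
  (cval chi x)^* * (psi chi)^*).

Let ball_Phi_in_L1 n y : in_L1 mu (fun x : borel K =>
  (\1_(lcball n y) x : R)%:C * Phi x).
Proof.
have mPhi : cmeasurable (Phi : borel K -> R[i]).
  apply: (cmeasurable_exhaust (A := fun k : nat => lcball (- k%:Z) 0 :
    set (borel K))).
  - by move=> k; exact: measurable_lcball.
  - by move=> x; have [k xk] := lball_exhaust x; exists k; rewrite lcball0.
  - by move=> k; have [] := multiplication_formula (in_L1_ball (- k%:Z) 0) psiJ.
under eq_fun do rewrite mulrC.
apply: (in_L1_bounded (c := 2 * fine (cLnorm nu 1 psi))) => //;
  last exact: in_L1_ball.
move=> x; rewrite -lee_fin.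
have xi : in_L1 nu (fun chi => (cval chi x)^* * (psi chi)^*).
  apply: in_L1_unimodular => //; first exact/cmeasurableJ/cmeasurable_eval.
  by move=> chi; rewrite normc_conj normc_cval.
apply: le_trans (normc_cintegral xi) _; rewrite EFinM fineK; last first.
  by rewrite ge0_fin_numE ?psi1.2//; exact: Lnorm_ge0.
rewrite (eq_cLnorm nu 1 (g := psi))// => chi.
by rewrite normcM !normc_conj normc_cval mul1r.
Qed.

(** Fourier inversion. The integral of [Phi] over a ball is given by the
   multiplication formula for the indicator of the ball and the conjugate of
   [psi], that of [phi] by [fourier_L2_ball]. *)
Let Phi_phi : {ae mu, forall x : borel K, Phi x = (phi x)^*}.
Proof.
have phi2 : in_L2 mu phi by case: phi_psi.
have phiJ n y : in_L1 mu (fun x : borel K =>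
  (\1_(lcball n y) x : R)%:C * phi x).
  by apply: in_L2M => //; exact: in_L2_ball.
apply: (ae_eq_balls F_finite) => [|n y|n y]; first exact: ball_Phi_in_L1.
  have := in_L1J (phiJ n y); congr in_L1; apply/funext => x.
  by rewrite conjcM conjcR.
have [<- _ _] := multiplication_formula (in_L1_ball n y) psiJ.
have vol0 : (fine (mu (lball n)))%:C * (fine (nu (perp n)))%:C = 1 :> R[i].
  by rewrite -real_complexM mu_lball_nu_perp.
have psig : in_L1 nu (fun chi => psi chi * ((\1_(perp n) chi)%:C * cval chi y)).
  under eq_fun do rewrite mulrC.
  apply: (in_L1_bounded (c := 1)) => //; first exact: (in_L1_perp_cval n y).1.
  move=> chi; rewrite normcM normc_cval mulr1 normc_real indicE.
  by case: (_ \in _); rewrite ?normr1 ?normr0 ?ler01.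
rewrite (eq_cintegral nu (g := fun chi => (fine (mu (lball n)))%:C *
    (psi chi * ((\1_(perp n) chi)%:C * cval chi y))^*)); last first.
  by move=> chi; rewrite fourier_lcball -mulrA (conjcM (psi chi))
    [(psi chi)^* * _]mulrC.
rewrite cintegralZl; last exact: in_L1J.
rewrite cintegralJ// (fourier_L2_ball n y phi_psi) conjcM conjcR mulrA vol0
  mul1r.
rewrite -cintegralJ; last exact: phiJ.
by apply: eq_cintegral => x; rewrite conjcM conjcR.
Qed.

(** The multiplication formula for the functions approximating [phi] and for
   [chi(c)] times the conjugate of [psi], whose transform is the translate by [c]
   of [conj phi] by inversion; then a passage to the limit on both sides. *)
Lemma fourier_correlation (c : K) :
  cintegral mu (fun x => phi x * (phi (x - c))^*) =
  cintegral nu (fun chi => psi chi * (psi chi)^* * cval chi c).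
Proof.
have [phi2 [psi2 [u [u12 u_phi u_psi]]]] := phi_psi.
pose g (chi : borel X) : R[i] := cval chi c * (psi chi)^*.
have gi : in_L1 nu g.
  apply: in_L1_unimodular; [exact: cmeasurable_eval|by move=> chi;
    rewrite normc_cval|exact: psiJ].
have g2 : in_L2 nu g.
  apply: (in_L2_eqnorm _ psi2); first exact: gi.1.
  by move=> chi; rewrite normcM normc_cval mul1r normc_conj.
have phic2 : in_L2 mu (fun x => (phi (x - c))^*).
  have := in_L2J (in_L2_preserving (measurable_shift (- c)) (mu_shift (- c))
    phi2).
  by congr in_L2; apply/funext => x; rewrite addrC.
have l1 : ccvg (fun k => cintegral nu (fun chi => fourier mu (u k) chi * g chi))
    (cintegral nu (fun chi => psi chi * g chi)).
  apply: L2_cvg_cintegral => // k; first exact/cmeasurable_fourier/(u12 k).1.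
  by apply: fourier_mul_in_L1 => //; exact: (u12 k).1.
have l2 : ccvg (fun k => cintegral mu (fun x => u k x * (phi (x - c))^*))
    (cintegral mu (fun x => phi x * (phi (x - c))^*)).
  apply: L2_cvg_cintegral => // k; first exact: (u12 k).1.1.
  by apply: in_L2M => //; exact: (u12 k).2.
rewrite (eq_cintegral nu (g := fun chi => psi chi * g chi)); last first.
  by move=> chi; rewrite -mulrA [(psi chi)^* * _]mulrC.
apply: ccvg_unique l2 _; move: l1; congr ccvg; apply/funext => k.
have [-> muPhi _] := multiplication_formula (u12 k).1 gi.
have E x : cintegral nu (fun chi => (cval chi x)^* * g chi) = Phi (x - c).
  apply: eq_cintegral => chi; rewrite /g mulrA cvalB conjcM conjcK//.
apply: ae_eq_cintegral.
- exact: muPhi.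
- by apply: cmeasurableM; [exact: (u12 k).1.1|exact: phic2.1].
- have := ae_preserving (measurable_shift (- c)) (mu_shift (- c)) Phi_phi.
  by apply: filterS => x; rewrite E addrC => ->.
Qed.

End correlation.

Lemma measurable_perp_coset n (zeta : X) :
  measurable ([set (chi * zeta)%g | chi in perp n] : set (borel X)).
Proof.
rewrite (_ : image _ _ = setT `&` (fun chi : X =>
  (zeta^-1 * chi)%g) @^-1` perp n).
  exact: measurable_mulg (measurable_annihilator _).
rewrite setTI; apply/seteqP; split=> [_ [chi nchi <-]|chi nchi] /=.
  by rewrite (character_mulC chi) mulKg.
by exists (zeta^-1 * chi)%g => //; rewrite (character_mulC _ zeta) mulKVg.
Qed.

Lemma cintegral_perp_coset n (zeta : X) (x : K) :
  cintegral nu (fun chi : borel X =>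
    (\1_[set (chi * zeta)%g | chi in perp n] chi : R)%:C * cval chi x) =
  cval zeta x * (fine (nu (perp n)) * \1_(lball n) x)%:C.
Proof.
rewrite -cintegral_perp -cintegralZl; last exact: in_L1_perp_cval.
rewrite -(cintegral_preserving (measurable_mulg zeta) (haar_mulg nu_haar zeta)).
  apply: eq_cintegral => chi; rewrite cvalM mulrCA; congr (_ * (_%:C * _)).
  rewrite !indicE; congr (_%:R); congr nat_of_bool; apply/idP/idP; rewrite !inE.
    by move=> [psi npsi]; rewrite character_mulC => /mulgI <-.
  by move=> nchi; exists chi => //; rewrite character_mulC.
apply: cmeasurableM; last exact: cmeasurable_eval.
by apply: cmeasurable_indic; exact: measurable_perp_coset.
Qed.

Lemma nu_perp_coset_lty n (zeta : X) :
  (nu [set (chi * zeta)%g | chi in perp n] < +oo)%E.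
Proof.
rewrite -(haar_mulg nu_haar zeta); last exact: measurable_perp_coset.
rewrite (_ : _ @^-1` _ = perp n) ?nu_perp_lty//; apply/seteqP; split=> chi /=.
  by move=> [psi npsi]; rewrite character_mulC => /mulgI <-.
by move=> nchi; exists chi => //; rewrite character_mulC.
Qed.

(** Translating each coset back to the annihilator brings out the value at [x] of
   its representative, which is all that distinguishes the cosets. *)
Lemma cintegral_perp_cosets n q (zeta : nat -> X) (x : K) :
  trivIset `I_q (fun j => [set (chi * zeta j)%g | chi in perp n]) ->
  cintegral nu (fun chi : borel X =>
    (\1_(\bigcup_(j in `I_q) [set (chi * zeta j)%g | chi in perp n]) chi : R)%:C
    * cval chi x) =
  (\sum_(j < q) cval (zeta j) x) * (fine (nu (perp n)) * \1_(lball n) x)%:C.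
Proof.
move=> tZ; pose A j : set (borel X) := [set (chi * zeta j)%g | chi in perp n].
have Ai j : in_L1 nu (fun chi : borel X => (\1_(A j) chi : R)%:C * cval chi x).
  under eq_fun do rewrite mulrC.
  apply: in_L1_unimodular; [exact: cmeasurable_eval|by move=> chi;
    rewrite normc_cval|].
  by apply: in_L1_indic;
    [exact: measurable_perp_coset|exact: nu_perp_coset_lty].
rewrite (eq_cintegral nu (g := fun chi : borel X =>
    \sum_(j < q) (\1_(A j) chi : R)%:C * cval chi x)).
  rewrite (cintegral_sum q (h := fun j (chi : borel X) =>
    (\1_(A j) chi : R)%:C * cval chi x))// mulr_suml; apply: eq_bigr => j _.
  exact: cintegral_perp_coset.
by move=> chi; rewrite -mulr_suml (indic_trivIset_bigcup _ _ tZ) rmorph_sum.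
Qed.

End Laurent_duality.

(** * The local field of Laurent series over a finite field *)

Section roots_of_unity.
Context {R : realType}.

(** If [a = pi * k / p], then [cos (2 * a) = 1] would force [sin a = 0], while
   [0 < a < pi]. *)
Lemma expi_neq1 (p k : nat) : (0 < k < p)%N ->
  expi (2 * pi / p%:R * k%:R : R) != 1.
Proof.
move=> /andP[k0 kp];
  have p0 : (0 : R) < p%:R by rewrite ltr0n (leq_trans k0)// ltnW.
set a : R := pi * (k%:R / p%:R).
have a0 : 0 < a by rewrite mulr_gt0 ?pi_gt0// divr_gt0// ltr0n.
have api : a < pi by rewrite gtr_pMr ?pi_gt0// ltr_pdivrMr// mul1r ltr_nat.
have -> : 2 * pi / p%:R * k%:R = a *+ 2 by rewrite /a mulr2n; ring.
rewrite /expi eq_complex /= negb_and; apply/orP; left.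
rewrite cos_mulr2n; apply/eqP => e.
have c1 : cos a ^+ 2 = 1 by lra.
have s0 : sin a ^+ 2 = 0 by have := cos2Dsin2 a; lra.
have : 0 < sin a by apply: sin_gt0_pi; rewrite a0 api.
by move/eqP : s0; rewrite sqrf_eq0 => /eqP ->; rewrite ltxx.
Qed.

End roots_of_unity.

Lemma H0_lcoef (p : nat) (f : {poly 'F_p}) (f_irr : monic_irreducible_poly f)
    (h : laurentGF f_irr) (j : int) :
  H0 f_irr h -> 0 <= j -> lcoef h j = 0.
Proof.
move=> [l [_ [a ->]]] j0; rewrite big_nat.
apply: (big_ind (fun x : laurentGF f_irr => lcoef x j = 0)) => //.
  by move=> x y x0 y0; rewrite lcoefD x0 y0 addr0.
move=> i /andP[i0 _]; rewrite lcoefZ lcoef_mono.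
by rewrite (_ : (j == - i%:Z) = false) ?mulr0n ?mulr0//; apply/eqP; lia.
Qed.

Section GF_Laurent.
Context {R : realType} {p s : nat} (p_prime : prime p).
Context {f : {poly 'F_p}} (f_irr : monic_irreducible_poly f).
Local Notation GF := {poly %/ f with f_irr}.
Local Notation K := (laurentGF f_irr).
Local Notation X := (character R K).
Local Notation r := (rchar R s p_prime (f_irr := f_irr)).

Lemma GF_finite : finite_set [set: GF].
Proof. exact: finite_finset. Qed.

Lemma GF_char : p%:R = 0 :> GF.
Proof.
have : p \in [pchar {poly %/ f}] by rewrite pchar_qpoly pchar_Fp.
by case/andP => _ /eqP.
Qed.

Lemma rchar_trivial k (u : GF) (x : K) : lcoef x k = 0 -> cval (r k u) x = 1.
Proof.
move=> xk; rewrite /rchar cvalE /rchar_fun big1// => l _.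
by rewrite xk /gcoord coef0 muln0 mulr0 expi0.
Qed.

Lemma rchar_perp k n (u : GF) : k < n -> Kperp R f_irr n (r k u).
Proof. by move=> kn x nx; apply: rchar_trivial; exact: nx. Qed.

Hypothesis f_size : size f = s.+1.

(** If [x] has a nonzero coordinate [x_j^(l)] with [j < n], take [r_j^u] for the
   [l]-th basis vector [u] of GF(p^s). *)
Lemma Kperp_separating n (x : K) : ~ lball n x ->
  exists2 chi : X, annihilator (lball n) chi & cval chi x != 1.
Proof.
move=> nx; have [j [jn xj]] : exists j, j < n /\ lcoef x j <> 0.
  apply: contrapT => h; apply: nx => j jn; apply: contrapT => xj.
  by apply: h; exists j.
have size_modulus : size (mk_monic f) = s.+1 by rewrite (mk_monicE f_irr).
have szx (v : GF) : (size (polyn v) <= s)%N.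
  by rewrite -ltnS -size_modulus; exact: size_mk_monic.
have [l ls xl] : exists2 l, (l < s)%N & (polyn (lcoef x j))`_l != 0.
  exists (size (polyn (lcoef x j))).-1.
    apply: leq_trans (szx (lcoef x j)); rewrite prednK// lt0n size_poly_eq0.
    by apply/eqP => e; apply: xj; apply: val_inj.
  rewrite -lead_coefE lead_coef_eq0.
  by apply/eqP => e; apply: xj; apply: val_inj.
pose u : GF := in_qpoly f 'X^l.
have uE i : gcoord u i = (i == l).
  rewrite /gcoord /u in_qpoly_small; last first.
    by rewrite size_modulus size_polyXn ltnS.
  by rewrite coefXn; case: (i == l).
exists (r j u); first exact: rchar_perp.
rewrite /rchar cvalE /rchar_fun (bigD1 (Ordinal ls))//= big1 ?mulr1; last first.
  move=> i il; rewrite uE; move: il; rewrite -val_eqE /= => /negbTE ->.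
  by rewrite mul0n mulr0 expi0.
rewrite uE eqxx mul1n; apply: expi_neq1; apply/andP; split.
  by rewrite lt0n; apply: contra xl => /eqP e; apply/eqP/val_inj.
by rewrite -[X in (_ < X)%N](Fp_cast p_prime) ltn_ord.
Qed.

(** Multiplying the cosets by characters [eta_j] trivial on [H_0] does not
   change the integral, and the cosets of the [xi_j] fill up the annihilator of
   [K_0], over which a nontrivial character integrates to zero. *)
Lemma cintegral_elementary (nu : {measure set (borel X) -> \bar R}) (N M : nat)
    (E : set X) (x : K) :
  is_haar (fun chi psi : X => (chi * psi)%g) nu ->
  nu (Kperp R f_irr 0) = 1%E -> elementary_set s p_prime N M E ->
  (forall j : int, 0 <= j -> lcoef x j = 0) ->
  [/\ measurable (E : set (borel X)), (nu E < +oo)%E &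
  cintegral nu (fun chi : borel X => (\1_E chi : R)%:C * cval chi x) =
    (x == 0)%:R].
Proof.
move=> nu_haar nu0 [alpha [beta H]] x0.
pose xi j : X := (\prod_(l < N) r (- N%:Z + l%:Z) (alpha j l))%g.
pose eta j : X := (\prod_(l < M) r l%:Z (beta j l))%g.
pose zeta j : X := (xi j * eta j)%g.
have [_ [tZ EE] [tX XE] _ _] := H.
have etaE j : cval (eta j) x = 1.
  rewrite /eta; apply: (big_ind (fun chi : X => cval chi x = 1)) => //.
    by move=> chi psi c1 p1; rewrite cvalM c1 p1 mulr1.
  by move=> l _; apply: rchar_trivial; exact: x0.
subst E; split.
- apply: bigcup_measurable => j _.
  exact: measurable_perp_coset.
- apply: measure_bigcup_fin_lty; first exact: finite_II.
    by move=> j; exact: measurable_perp_coset.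
  move=> j.
  exact: (nu_perp_coset_lty (prime_gt0 p_prime) GF_finite GF_char nu_haar nu0).
- have cosets := cintegral_perp_cosets (prime_gt0 p_prime)
    GF_finite GF_char nu_haar nu0 Kperp_separating.
  rewrite (cosets _ _ _ _ tZ).
  have -> : \sum_(j < p ^ (s * N)) cval (zeta j) x = \sum_(j < p ^ (s * N))
    cval (xi j) x.
    by apply: eq_bigr => j _; rewrite /zeta cvalM etaE mulr1.
  rewrite -(cosets _ _ _ _ tX) XE.
  rewrite (cintegral_perp (prime_gt0 p_prime) GF_finite GF_char nu_haar nu0
    Kperp_separating).
  rewrite nu0 mul1r indicE; have [->|xne] := eqVneq x 0;
    first by rewrite mem_set.
  rewrite memNset// => xb; move/eqP : xne; apply; apply: laurentP => j.
  by case: (ltP j 0) => [/xb|/x0].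
Qed.

End GF_Laurent.

Theorem theorem7p1 (R : realType) (p s : nat) (p_prime : prime p)
    (s_gt0 : (0 < s)%N) (f : {poly 'F_p}) (f_irr : monic_irreducible_poly f)
    (f_size : size f = s.+1)
    (mu : {measure set (borel (laurentGF f_irr)) -> \bar R})
    (mu_haar : is_haar (fun x y : laurentGF f_irr => x + y) mu)
    (mu_K0 : mu (lball 0) = 1%E)
    (nu : {measure set
      (borel (character R (laurentGF f_irr))) -> \bar R})
    (nu_haar :
      is_haar (fun x y : character R (laurentGF f_irr) => (x * y)%g) nu)
    (nu_K0 : nu (Kperp R f_irr 0) = 1%E)
    (M N : nat) (M_gt0 : (0 < M)%N) (N_gt0 : (0 < N)%N)
    (E : set (character R (laurentGF f_irr)))
    (E_sub : E `<=` Kperp R f_irr M%:Z)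
    (E_elem : elementary_set s p_prime N M E)
    (phi : laurentGF f_irr -> R[i])
    (phi_L2 : in_L2 mu phi)
    (phihat : character R (laurentGF f_irr) -> R[i])
    (phihat_fourier : fourier_L2 mu nu phi phihat)
    (phihat_abs : {ae nu, forall chi, normc (phihat chi) = \1_E chi}) :
  orthonormal_system mu (H0 f_irr) (fun h x => phi (x - h)).
Proof.
have p_gt0 := prime_gt0 p_prime.
have separating := Kperp_separating p_prime (f_irr := f_irr) f_size (R := R).
have [_ [phihat_L2 _]] := phihat_fourier.
have shift_L2 (h : laurentGF f_irr) :
  in_L2 mu (fun x : borel (laurentGF f_irr) => phi (x - h)).
  have := in_L2_preserving (measurable_shift (- h)) (mu_shift mu_haar (- h))
    phi_L2.
  by congr in_L2; apply/funext => x; rewrite addrC.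
split=> [h _|h k Hh Hk]; first exact: shift_L2.
have hk_neg (j : int) : 0 <= j -> lcoef (k - h) j = 0.
  by move=> j0; rewrite lcoefB (H0_lcoef Hk j0) (H0_lcoef Hh j0) subrr.
have [mE nuE intE] := cintegral_elementary f_size nu_haar nu_K0 E_elem hk_neg.
have abs_ae : {ae nu, forall chi : borel (character R (laurentGF f_irr)),
    normc (phihat chi) = \1_E chi} by [].
have phihat_L1 : in_L1 nu phihat.
  split; first exact: phihat_L2.1.
  rewrite cLnorm1E (ae_eq_integral (fun chi :
    borel (character R (laurentGF f_irr)) => (\1_E chi)%:E))//.
  - by rewrite integral_indic// setIT.
  - exact/measurable_EFinP/measurable_normc/phihat_L2.1.
  - exact/measurable_EFinP/measurable_indic.
  - by apply: filterS abs_ae => chi ->.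
transitivity (cintegral mu (fun x : borel (laurentGF f_irr) =>
  phi x * (phi (x - (k - h)))^*)).
  rewrite -[LHS](cintegral_preserving (measurable_shift h)
    (mu_shift mu_haar h)); last first.
    apply: cmeasurableM;
      [exact: (shift_L2 h).1|exact: cmeasurableJ (shift_L2 k).1].
  apply: eq_cintegral => x; congr (phi _ * (phi _)^*);
    first by rewrite addrC addKr.
  by rewrite opprB addrA [h + x]addrC.
rewrite (fourier_correlation p_gt0 (GF_finite f_irr) (GF_char p_prime f_irr)
  mu_haar nu_haar mu_K0 nu_K0 separating phihat_fourier phihat_L1).
transitivity (cintegral nu (fun chi : borel (character R (laurentGF f_irr)) =>
  (\1_E chi : R)%:C%C * cval chi (k - h))).
  apply: ae_eq_cintegral.
  - apply: cmeasurableM; last exact: cmeasurable_eval.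
    by apply: cmeasurableM;
      [exact: phihat_L2.1|exact: cmeasurableJ phihat_L2.1].
  - by apply: cmeasurableM; [exact: cmeasurable_indic|exact: cmeasurable_eval].
  - apply: filterS abs_ae => chi abs1; rewrite mulc_conj abs1 indicE.
    by case: (chi \in E); rewrite ?expr1n ?expr0n.
by rewrite intE subr_eq0 eq_sym.
Qed.
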